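(* Let $\Gamma$ be a planar trivalent graph with a planar presentation, and let $\psi:H\to \mathrm{SL}_2(\mathbb{C})$ be a holonomy (discrete connection). For each half-edge $h$ let $F_h=\mathbb{R}^2$ with coordinates $x_h=(z_h,w_h)$, and for half-edges $g,h$ put $b_{g,h}(x_g,x_h)=i(z_gw_h-z_hw_g)$ (extended bilinearly to $\mathbb{C}^2\times\mathbb{C}^2$). Let $\mathcal{Q}$ be the $R_X$-valued quadratic form on $\bigoplus_{h\in H}F_h$ given by $$\mathcal{Q}(x)=2\sum_{\alpha:g\to h} b_{g,h}(\psi_g^{-1}x_g,\psi_h^{-1}x_h)\,X_\alpha+2\sum_{e:g\to h} b_{g,h}(x_g,x_h),$$ where the first sum is over angles $\alpha=\{g,h\}$ and the second over edges $e$ with half-edges $g,h$, in both cases labelled so that $g<h$ in the presentation. Then $$Z(\Gamma,\psi)=\det(\mathcal{Q})^{-1/2},$$ where the determinant is that of the matrix of $\mathcal{Q}$ in the canonical basis.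
   Context: **Graphs.** $\Gamma$ is a finite connected trivalent graph with at least one vertex, loops and multiple edges allowed, with vertex set $V$, edge set $E$, and set $H$ of half-edges (each edge $e$ is divided into two half-edges; a half-edge is written $(e,v)$, $v$ being the end of $e$ it touches). At each vertex the three half-edges carry a cyclic order. An angle is an unordered pair of distinct half-edges at the same vertex; $A$ is the set of angles (three per vertex). **Colorings.** An admissible coloring is a map $c:E\to\mathbb{N}=\{0,1,2,\dots\}$ such that at every vertex, with incident edges $i,j,k$, $c_i+c_j+c_k$ is even and $c_i\le c_j+c_k$, $c_j\le c_i+c_k$, $c_k\le c_i+c_j$. For the angle $\alpha$ between $i$ and $j$ at a vertex with third edge $k$, put $c_\alpha=(c_i+c_j-c_k)/2$. **Presentations.** A presentation of $\Gamma$ is a total order on $H$ (''from left to right'') for which the three half-edges at each vertex are consecutive and, listed increasingly as $v_1<v_2<v_3$, follow the cyclic order at $v$. For an edge $e$ let $e_1<e_2$ be its half-edges. Two edges $e,e'$ cross if $e_1<e'_1<e_2<e'_2$ or $e'_1<e_1<e'_2<e_2$. (Picture: vertices on a horizontal line, half-edges going up, edges drawn as arcs above the line.) If $\Gamma$ is planar, i.e. embedded in the plane with all cyclic orders induced by one orientation of the plane, a planar presentation is one for which $\sum_{\{e,e'\}\text{ crossing}}c_ec_{e'}$ is even for every admissible coloring $c$. **Evaluation.** For $\psi:H\to\mathrm{SL}_2(\mathbb{C})$ and $c$ admissible, $$\langle\Gamma,c,\psi\rangle=(-1)^{\sum_{\{e,e'\}\text{ crossing}}c_ec_{e'}}\prod_{e\in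 E}\frac{1}{(c_e!)^2}\Big(\frac{\partial}{\partial z_{e_1}}\frac{\partial}{\partial w_{e_2}}-\frac{\partial}{\partial z_{e_2}}\frac{\partial}{\partial w_{e_1}}\Big)^{c_e}\ \prod_{v\in V}\epsilon_v,$$ where $(z_h,w_h)$, $h\in H$, are independent variables and $\epsilon_v$ is the polynomial $$(z_{v_2}w_{v_1}-z_{v_1}w_{v_2})^{\frac{c_{v_1}+c_{v_2}-c_{v_3}}2}(z_{v_3}w_{v_2}-z_{v_2}w_{v_3})^{\frac{c_{v_2}+c_{v_3}-c_{v_1}}2}(z_{v_3}w_{v_1}-z_{v_1}w_{v_3})^{\frac{c_{v_1}+c_{v_3}-c_{v_2}}2}$$ in which each $(z_h,w_h)$ has been replaced by $\psi_h^{-1}(z_h,w_h)$ (column vectors); $c_{v_i}$ is the color of the edge containing $v_i$. (This is independent of the presentation.) **Generating series.** $R_X=\mathbb{C}[[X_\alpha,\alpha\in A]]$, $X^c=\prod_{\alpha}X_\alpha^{c_\alpha}$, $$\langle\langle\Gamma,c,\psi\rangle\rangle=\langle\Gamma,c,\psi\rangle\frac{\prod_{e}c_e!}{\prod_\alpha c_\alpha!},\qquad Z(\Gamma,\psi)=\sum_{c\text{ admissible}}\langle\langle\Gamma,c,\psi\rangle\rangle X^c\in R_X.$$ **Determinant.** The matrix of a quadratic form $q$ is the symmetric matrix $M$ with $q(x)=x^TMx$. $\det(\mathcal{Q})$ is a polynomial in the $X_\alpha$ with constant term $1$, and $\det(\mathcal{Q})^{-1/2}$ denotes the formal power series with constant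 term $1$ whose square is $\det(\mathcal{Q})^{-1}$. *)

(* Defs.v *)
From HB Require Import structures.
From mathcomp Require Import all_boot all_order all_algebra.
From mathcomp Require Import boolp classical_sets set_interval reals topology.
From mathcomp Require Import complex mpoly zify.
Import Order.TTheory GRing.Theory Num.Theory.
Import numFieldTopology.Exports.

Set Implicit Arguments.
Unset Strict Implicit.
Unset Printing Implicit Defensive.

Local Open Scope ring_scope.
Local Open Scope complex_scope.

Record fps (n : nat) (C : Type) := Fps { fps_coef : 'X_{1..n} -> C }.

HB.lock Definition fps_add (n : nat) (C : comNzRingType) (s t : fps n C) :=
  Fps (fun m => fps_coef s m + fps_coef t m).

HB.lock Definition fps_opp (n : nat) (C : comNzRingType) (s : fps n C) :=
  Fps (fun m => - fps_coef s m).

HB.lock Definition fps_mul (n : nat) (C : comNzRingType) (s t : fps n C) :=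
  Fps (fun m =>
    \sum_(k : 'X_{1..n < (mdeg m).+1, (mdeg m).+1} | m == (k.1 + k.2)%MM)
       fps_coef s k.1 * fps_coef t k.2).

HB.lock Definition fpsC (n : nat) (C : comNzRingType) (a : C) : fps n C :=
  Fps (fun m => if m == 0%MM then a else 0).

Section FpsRing.
Variables (n : nat) (C : comNzRingType).
Local Notation S := (fps n C).
Implicit Types (s t u : S) (m : 'X_{1..n}) (a : C).

HB.instance Definition _ := gen_eqMixin S.
HB.instance Definition _ := gen_choiceMixin S.

Lemma fpsP s t : (forall m, fps_coef s m = fps_coef t m) -> s = t.
Proof. by case: s t => [s] [t] /= /funext ->. Qed.

Let addE s t m : fps_coef (fps_add s t) m = fps_coef s m + fps_coef t m.
Proof. by rewrite unlock. Qed.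
Let oppE s m : fps_coef (fps_opp s) m = - fps_coef s m.
Proof. by rewrite unlock. Qed.
Let mulE s t m : fps_coef (fps_mul s t) m =
  \sum_(k : 'X_{1..n < (mdeg m).+1, (mdeg m).+1} | m == (k.1 + k.2)%MM)
     fps_coef s k.1 * fps_coef t k.2.
Proof. by rewrite unlock. Qed.

Lemma fps_coefC a m : fps_coef (fpsC n a) m = if m == 0%MM then a else 0.
Proof. by rewrite unlock. Qed.

Lemma fps_addA : associative (@fps_add n C).
Proof. by move=> s t u; apply: fpsP => m; rewrite !addE addrA. Qed.
Lemma fps_addC : commutative (@fps_add n C).
Proof. by move=> s t; apply: fpsP => m; rewrite !addE addrC. Qed.
Lemma fps_add0 : left_id (fpsC n 0) (@fps_add n C).
Proof. by move=> s; apply: fpsP => m; rewrite addE fps_coefC if_same add0r. Qed.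
Lemma fps_addN : left_inverse (fpsC n 0) (@fps_opp n C) (@fps_add n C).
Proof. by move=> s; apply: fpsP => m; rewrite addE oppE fps_coefC if_same addNr. Qed.

HB.instance Definition _ :=
  GRing.isZmodule.Build S fps_addA fps_addC fps_add0 fps_addN.

Definition fps_trunc d s : {mpoly C[n]} :=
  \sum_(k : 'X_{1..n < d}) fps_coef s k *: 'X_[k].

Lemma fps_truncE d s m : (mdeg m < d)%N -> (fps_trunc d s)@_m = fps_coef s m.
Proof. exact: mcoeff_mpoly. Qed.

Lemma fps_mulE d s t m : (mdeg m < d)%N ->
  fps_coef (fps_mul s t) m = (fps_trunc d s * fps_trunc d t)@_m.
Proof.
move=> md; rewrite mulE mcoeffM /=; apply: eq_bigr => -[k1 k2] /= /eqP Em.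
have md' : (mdeg k1 + mdeg k2 < d)%N by rewrite -mdegD -Em.
rewrite !fps_truncE //.
  exact: leq_ltn_trans (leq_addl _ _) md'.
exact: leq_ltn_trans (leq_addr _ _) md'.
Qed.

Lemma mcoeffM_low d (p p' q q' : {mpoly C[n]}) m : (mdeg m < d)%N ->
  (forall k, (mdeg k < d)%N -> p@_k = p'@_k) ->
  (forall k, (mdeg k < d)%N -> q@_k = q'@_k) -> (p * q)@_m = (p' * q')@_m.
Proof.
move=> md pp qq; rewrite !mcoeffM; apply: eq_bigr => -[k1 k2] /= /eqP Em.
have md' : (mdeg k1 + mdeg k2 < d)%N by rewrite -mdegD -Em.
rewrite pp ?qq //.
  exact: leq_ltn_trans (leq_addl _ _) md'.
exact: leq_ltn_trans (leq_addr _ _) md'.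
Qed.

Lemma fps_mulA : associative (@fps_mul n C).
Proof.
move=> s t u; apply: fpsP => m; have md := ltnSn (mdeg m).
rewrite !(fps_mulE _ _ md).
set d := (mdeg m).+1 in md *.
transitivity (fps_trunc d s * (fps_trunc d t * fps_trunc d u))@_m.
  apply: (mcoeffM_low md) => // k kd.
  by rewrite fps_truncE // (fps_mulE _ _ kd).
rewrite mulrA; apply: (mcoeffM_low md) => // k kd.
by rewrite fps_truncE // (fps_mulE _ _ kd).
Qed.

Lemma fps_mulC : commutative (@fps_mul n C).
Proof.
move=> s t; apply: fpsP => m; have md := ltnSn (mdeg m).
by rewrite !(fps_mulE _ _ md) mulrC.
Qed.

Lemma fps_mul1 : left_id (fpsC n 1) (@fps_mul n C).
Proof.
move=> s; apply: fpsP => m; have md := ltnSn (mdeg m).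
rewrite (fps_mulE _ _ md) -[RHS](fps_truncE _ md) -[in RHS](mul1r (fps_trunc _ _)).
apply: (mcoeffM_low md) => // k kd.
by rewrite fps_truncE // fps_coefC mcoeff1; case: (k == _).
Qed.

Lemma fps_mulDl : left_distributive (@fps_mul n C) (@fps_add n C).
Proof.
move=> s t u; apply: fpsP => m; rewrite addE !mulE -big_split /=.
by apply: eq_bigr => k _; rewrite addE mulrDl.
Qed.

Lemma fps_one_neq0 : fpsC n 1 != 0 :> S.
Proof.
apply/eqP => /(congr1 (fun s => fps_coef s 0%MM)).
by rewrite !fps_coefC eqxx; apply/eqP; rewrite oner_eq0.
Qed.

HB.instance Definition _ := GRing.Zmodule_isComNzRing.Build S
  fps_mulA fps_mulC fps_mul1 fps_mulDl fps_one_neq0.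

Lemma fps_coef0 m : fps_coef (0 : S) m = 0.
Proof. by rewrite fps_coefC if_same. Qed.
Lemma fps_coef1 m : fps_coef (1 : S) m = (m == 0%MM)%:R.
Proof. by rewrite fps_coefC; case: (m == _). Qed.
Lemma fps_coefD s t m : fps_coef (s + t) m = fps_coef s m + fps_coef t m.
Proof. exact: addE. Qed.
Lemma fps_coefN s m : fps_coef (- s) m = - fps_coef s m.
Proof. exact: oppE. Qed.
Lemma fps_coefM s t m : fps_coef (s * t) m =
  \sum_(k : 'X_{1..n < (mdeg m).+1, (mdeg m).+1} | m == (k.1 + k.2)%MM)
     fps_coef s k.1 * fps_coef t k.2.
Proof. exact: mulE. Qed.

Definition fpsX (i : 'I_n) : S := Fps (fun m => (m == U_(i)%MM)%:R).

(** [s] is the power series [d ^ (-1/2)] with constant term 1. *)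
Definition is_inv_sqrt (d s : S) : Prop :=
  fps_coef s 0%MM = 1 /\ s ^+ 2 * d = 1.

End FpsRing.

(** [nxt] moves to the next half-edge at the same vertex.  A vertex has three
    half-edges, so [nxt_neq] and [nxt3] say that [nxt] permutes them as a
    3-cycle, i.e. that it is a cyclic order.  A loop is an edge whose two
    half-edges have the same [vtx]. *)
Record trivalent_graph := TrivalentGraph {
  vertex : finType;
  edge : finType;
  half_edge : finType;
  vtx : half_edge -> vertex;
  edg : half_edge -> edge;
  nxt : half_edge -> half_edge;
  card_vtx : forall v, #|[set h | vtx h == v]| = 3;
  card_edg : forall e, #|[set h | edg h == e]| = 2;
  vtx_nxt : forall h, vtx (nxt h) = vtx h;
  nxt_neq : forall h, nxt h != h;
  nxt3 : forall h, nxt (nxt (nxt h)) = h;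
  vertex_gt0 : (0 < #|vertex|)%N;
  graph_connected : forall u v,
    connect [rel x y | [exists g, exists h,
               [&& edg g == edg h, vtx g == x & vtx h == y]]] u v
}.

Section Planarity.
Variables (R : realType) (G : trivalent_graph).

Definition det2 (a b : R * R) : R := a.1 * b.2 - a.2 * b.1.

(** Three plane vectors are nonzero, have distinct directions and are met in
    the order a, b, c when turning counterclockwise: at most one of the three
    successive angles can be at least pi. *)
Definition counterclockwise (a b c : R * R) : bool :=
  (2 <= (0 < det2 a b)%R + (0 < det2 b c)%R + (0 < det2 c a)%R)%N.

(** An embedding of the topological realization of the graph in the plane:
    [arc h] restricted to [0, 1] runs along the half-edge [h] from its vertex
    to the middle of its edge.  The arcs are straight near the vertices (any
    plane graph is isotopic to such a one), so that the cyclic orders at the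
    vertices can be read off from the initial directions [dir]. *)
Definition planar : Prop :=
  exists (arc : half_edge G -> R -> R * R) (dir : half_edge G -> R * R),
  [/\ forall h, {within `[0, 1], continuous (arc h)}%classic,
      forall g h s t, s \in `[0, 1] -> t \in `[0, 1] ->
        arc g s = arc h t <->
        [\/ g = h /\ s = t,
            [/\ s = 0, t = 0 & vtx g = vtx h] |
            [/\ s = 1, t = 1 & edg g = edg h]],
      forall h, exists2 r, 0 < r & forall t, 0 <= t <= r ->
        arc h t = ((arc h 0).1 + t * (dir h).1, (arc h 0).2 + t * (dir h).2) &
      (forall h, counterclockwise (dir h) (dir (nxt h)) (dir (nxt (nxt h)))) \/
      (forall h, counterclockwise (dir (nxt (nxt h))) (dir (nxt h)) (dir h))].

End Planarity.

Section Colorings.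
Variable G : trivalent_graph.
Implicit Type c : edge G -> nat.

Definition angle : Type :=
  {a : {set half_edge G} | (#|a| == 2) &&
                           [forall g in a, forall h in a, vtx g == vtx h]}.
HB.instance Definition _ := Finite.on angle.

(** The two sums below are c_i + c_j + c_k and, for the half-edge [h] at its
    vertex, the sum of the colors of the two others; they run over half-edges,
    so that a loop counts twice. *)
Definition admissible c : bool :=
  [forall v, ~~ odd (\sum_(h | vtx h == v) c (edg h))] &&
  [forall h, (c (edg h) <=
              \sum_(g | (vtx g == vtx h) && (g != h)) c (edg g))%N].

(** The third half-edge, as a singleton. *)
Definition angle_compl (a : angle) : {set half_edge G} :=
  [set h | (h \notin val a) && [exists g in val a, vtx g == vtx h]].

Definition angle_color c (a : angle) : nat :=
  (\sum_(h in val a) c (edg h) - \sum_(h in angle_compl a) c (edg h))./2.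

(** Exponents of the monomial X^c. *)
Definition angle_mnm c : 'X_{1..#|{: angle}|} :=
  [multinom angle_color c (enum_val i) | i < #|{: angle}|].

Lemma vtx_half (g h : half_edge G) : (vtx g == vtx h) = (g \in [set h; nxt h; nxt (nxt h)]).
Proof.
have n1 := nxt_neq h; have n2 := nxt_neq (nxt h).
have n3 : nxt (nxt h) != h.
  by apply/eqP => E; have := nxt_neq h; rewrite -{2}(nxt3 h) E eqxx.
have sub : [set h; nxt h; nxt (nxt h)] \subset [set k | vtx k == vtx h].
  by apply/fintype.subsetP => k /[!inE] /orP[/orP[]|] /eqP ->; rewrite ?vtx_nxt.
have : #|[set h; nxt h; nxt (nxt h)]| = #|[set k | vtx k == vtx h]|.
  by rewrite card_vtx -finset.setUA cardsU1 cards2 !inE negb_or (eq_sym h) n1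
       (eq_sym h) n3 (eq_sym (nxt h)) n2.
by move=> cE; rewrite (subset_cardP cE sub) inE.
Qed.

Lemma admissible_bound c e : admissible c -> (c e <= mdeg (angle_mnm c))%N.
Proof.
move=> /andP[/forallP even /forallP adm].
have [h he] : exists h, edg h = e.
  have : (0 < #|[set h | edg h == e]|)%N by rewrite card_edg.
  by case/card_gt0P => h /[!inE] /eqP; exists h.
pose h1 := nxt h; pose h2 := nxt h1.
have vE g : (vtx g == vtx h) = [|| g == h, g == h1 | g == h2].
  by rewrite vtx_half !inE orbA.
have n1 : h1 != h by exact: nxt_neq.
have n2 : h2 != h1 by exact: nxt_neq.
have n3 : h2 != h.
  by apply/eqP => E; have := nxt_neq h; rewrite -{2}(nxt3 h) -/h1 -/h2 E eqxx.
have angP a b : a != b -> vtx a = vtx h -> vtx b = vtx h ->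
    (#|[set a; b]| == 2) &&
    [forall x in [set a; b], forall y in [set a; b], vtx x == vtx y].
  move=> nab va vb; rewrite cards2 nab /=.
  by apply/forall_inP => x xab; apply/forall_inP => y yab; move: xab yab;
     rewrite !inE => /orP[] /eqP-> /orP[] /eqP->; rewrite ?va ?vb.
have vh1 : vtx h1 = vtx h by rewrite vtx_nxt.
have vh2 : vtx h2 = vtx h by rewrite !vtx_nxt.
pose a1 : angle := Sub [set h; h1] (angP h h1 (negbT (etrans (eq_sym _ _) (negbTE n1))) erefl vh1).
pose a2 : angle := Sub [set h; h2] (angP h h2 (negbT (etrans (eq_sym _ _) (negbTE n3))) erefl vh2).
have colE a b d (A : angle) : val A = [set a; b] -> vtx a = vtx h ->
    vtx b = vtx h -> a != b -> d != a -> d != b ->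
    (forall g, (vtx g == vtx h) = [|| g == a, g == b | g == d]) ->
    angle_color c A = (c (edg a) + c (edg b) - c (edg d))./2.
  move=> EA va vb nab nda ndb all3; rewrite /angle_color EA.
  have -> : angle_compl A = [set d].
    apply/setP => g; rewrite !inE EA.
    have -> : [exists x in [set a; b], vtx x == vtx g] = (vtx g == vtx h).
      apply/exists_inP/idP => [[x]|vg].
        by rewrite !inE => /orP[] /eqP -> /eqP <-; rewrite ?va ?vb.
      by exists a; rewrite ?inE ?eqxx // va eq_sym.
    rewrite all3 !inE; case: (g =P a) => [->|_]; first by apply/esym/negbTE; rewrite eq_sym.
    by case: (g =P b) => [->|_]; rewrite ?andbT //=; apply/esym/negbTE; rewrite eq_sym.
  by rewrite big_set1 big_setU1 ?inE //= big_set1.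
have c1 : angle_color c a1 = (c (edg h) + c (edg h1) - c (edg h2))./2.
  by apply: colE => //; rewrite // eq_sym.
have c2 : angle_color c a2 = (c (edg h) + c (edg h2) - c (edg h1))./2.
  by apply: colE => //; rewrite 1?eq_sym // => g; rewrite vE [(g == h2) || _]orbC.
have n12 : a1 != a2.
  apply/eqP => /(congr1 val) /= /setP /(_ h1).
  by rewrite !inE eqxx orbT (negbTE n1) eq_sym (negbTE n2).
have ad k x y : vtx x = vtx k -> vtx y = vtx k -> x != k -> y != k -> x != y ->
    vtx k = vtx h -> (forall g, (vtx g == vtx h) = [|| g == k, g == x | g == y]) ->
    (c (edg k) <= c (edg x) + c (edg y))%N.
  move=> vx vy nx ny nxy vk all3; apply: leq_trans (adm k) _.
  rewrite (eq_bigl [pred g | g \in [set x; y]]).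
    by rewrite big_setU1 ?inE //= big_set1.
  move=> g /=; rewrite vk all3 !inE.
  case: (g =P k) => [->|_] /=; last by rewrite andbT.
  by rewrite ![k == _]eq_sym (negbTE nx) (negbTE ny).
have t1 : (c (edg h1) <= c (edg h) + c (edg h2))%N.
  apply: ad => //; rewrite ?vh1 ?vh2 1?eq_sym // => g.
  by rewrite vE; case: (g == h); case: (g == h1).
have t2 : (c (edg h2) <= c (edg h) + c (edg h1))%N.
  apply: ad => //; rewrite ?vh1 ?vh2 1?eq_sym // => g.
  by rewrite vE; case: (g == h); case: (g == h1); case: (g == h2).
have -> : mdeg (angle_mnm c) = (\sum_(a : angle) angle_color c a)%N.
  rewrite mdegE (reindex (@enum_rank angle)) /=; last first.
    by apply: onW_bij; exact: enum_rank_bij.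
  by apply: eq_bigr => a _; rewrite mnmE enum_rankK.
have := even (vtx h).
have -> : (\sum_(g | vtx g == vtx h) c (edg g) =
           c (edg h) + (c (edg h1) + c (edg h2)))%N.
  rewrite (eq_bigl [pred g | g \in [set h; h1; h2]]); last first.
    by move=> g; rewrite vtx_half.
  by rewrite -finset.setUA !big_setU1 ?inE ?negb_or 1?eq_sym ?n1 ?n2 //= 1?eq_sym
             ?n3 // big_set1.
rewrite (bigD1 a1) //= (bigD1 a2) 1?eq_sym //= c1 c2 he.
move: t1 t2; rewrite he; move: (c e) (c (edg h1)) (c (edg h2)) => x y z t1 t2.
lia.
Qed.

End Colorings.

Record presentation (G : trivalent_graph) := Presentation {
  ple : rel (half_edge G);
  ple_refl : reflexive ple;
  ple_anti : antisymmetric ple;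
  ple_trans : transitive ple;
  ple_total : total ple;
  ple_consecutive : forall g h k,
    ple g h -> ple h k -> vtx g = vtx k -> vtx h = vtx g;
  ple_cyclic : forall g h k, g != h -> h != k -> ple g h -> ple h k ->
    vtx g = vtx h -> vtx h = vtx k ->
    [/\ nxt g = h, nxt h = k & nxt k = g]
}.

Section Crossings.
Variables (G : trivalent_graph) (P : presentation G).

Definition plt : rel (half_edge G) := [rel g h | (g != h) && ple P g h].

Lemma size_vhalves v : size (sort (ple P) (enum [set h | vtx h == v])) == 3.
Proof. by rewrite size_sort -cardE card_vtx. Qed.
Lemma size_ehalves e : size (sort (ple P) (enum [set h | edg h == e])) == 2.
Proof. by rewrite size_sort -cardE card_edg. Qed.

(** Half-edges v_1 < v_2 < v_3 of a vertex and e_1 < e_2 of an edge. *)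
Definition vhalves v : 3.-tuple (half_edge G) := Tuple (size_vhalves v).
Definition v1 v := tnth (vhalves v) ord0.
Definition v2 v := tnth (vhalves v) (inord 1).
Definition v3 v := tnth (vhalves v) ord_max.
Definition ehalves e : 2.-tuple (half_edge G) := Tuple (size_ehalves e).
Definition e1 e := tnth (ehalves e) ord0.
Definition e2 e := tnth (ehalves e) ord_max.

(** Each unordered crossing pair {e, f} satisfies [crossing] for exactly one of
    its two orderings, so it is counted once in [crossing_sum]. *)
Definition crossing (e f : edge G) : bool :=
  [&& plt (e1 e) (e1 f), plt (e1 f) (e2 e) & plt (e2 e) (e2 f)].

Definition crossing_sum (c : edge G -> nat) : nat :=
  (\sum_e \sum_(f | crossing e f) c e * c f)%N.

Definition planar_presentation : Prop :=
  forall c, admissible c -> ~~ odd (crossing_sum c).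

End Crossings.

(** The ring R_X; the variable X_alpha is [fpsX _ (enum_rank alpha)]. *)
Notation RX R G := (fps #|{: angle G}| R[i]).

Section Evaluation.
Variables (R : realType) (G : trivalent_graph) (P : presentation G).
Local Notation C := R[i].
Local Notation RXG := (RX R G).
Variable psi : half_edge G -> 'M[C]_2.
Implicit Types (g h : half_edge G) (c : edge G -> nat).

(** Coordinates of \bigoplus_h F_h: [(h, 0)] stands for z_h and [(h, 1)] for
    w_h. *)
Definition ncoord : nat := #|{: half_edge G * 'I_2}|.
Definition zi h : 'I_ncoord := enum_rank (h, 0).
Definition wi h : 'I_ncoord := enum_rank (h, 1).

(** psi_h^{-1} (z_h, w_h) *)
Definition zpsi h : {mpoly C[ncoord]} :=
  invmx (psi h) 0 0 *: 'X_(zi h) + invmx (psi h) 0 1 *: 'X_(wi h).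
Definition wpsi h : {mpoly C[ncoord]} :=
  invmx (psi h) 1 0 *: 'X_(zi h) + invmx (psi h) 1 1 *: 'X_(wi h).

Definition vertex_poly c v : {mpoly C[ncoord]} :=
  let: (h1, h2, h3) := (v1 P v, v2 P v, v3 P v) in
  let: (c1, c2, c3) := (c (edg h1), c (edg h2), c (edg h3)) in
  (zpsi h2 * wpsi h1 - zpsi h1 * wpsi h2) ^+ (c1 + c2 - c3)./2 *
  (zpsi h3 * wpsi h2 - zpsi h2 * wpsi h3) ^+ (c2 + c3 - c1)./2 *
  (zpsi h3 * wpsi h1 - zpsi h1 * wpsi h3) ^+ (c1 + c3 - c2)./2.

Definition edge_op e (p : {mpoly C[ncoord]}) : {mpoly C[ncoord]} :=
  p^`M(wi (e2 P e))^`M(zi (e1 P e)) - p^`M(wi (e1 P e))^`M(zi (e2 P e)).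

(** The edge operators commute, so the order of [enum] is irrelevant.  For an
    admissible coloring each (z_h, w_h) occurs with total degree [c (edg h)] and
    is derived that many times: the result is a constant polynomial. *)
Definition evaluation_poly c : {mpoly C[ncoord]} :=
  foldr (fun e p => ((c e)`!%:R ^- 2) *: iter (c e) (edge_op e) p)
        (\prod_v vertex_poly c v) (enum (edge G)).

Definition evaluation c : C :=
  (-1) ^+ crossing_sum P c * (evaluation_poly c)@_0%MM.

Definition evaluation_normalized c : C :=
  evaluation c * (\prod_e (c e)`!%:R) /
  \prod_(a : angle G) (angle_color c a)`!%:R.

(** The coefficient of X^m is the sum over all admissible colorings with
    X^c = X^m; they take values at most |m| by [admissible_bound]. *)
Definition gen_series : RXG := Fps (fun m =>
  \sum_(c : {ffun edge G -> 'I_(mdeg m).+1} |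
           admissible (val \o c) && (angle_mnm (val \o c) == m))
     evaluation_normalized (val \o c)).

Definition bform (x y : 'cV[C]_2) : C := 'i%C * (x 0 0 * y 1 0 - y 0 0 * x 1 0).

Definition hcoord (x : 'cV[R]_ncoord) h : 'cV[C]_2 :=
  \col_(k < 2) (x (enum_rank (h, k)) 0)%:C.

Definition Qform (x : 'cV[R]_ncoord) : RXG :=
  2%:R * (\sum_(a : angle G) \sum_(g in val a) \sum_(h in val a | plt P g h)
           fpsC _ (bform (invmx (psi g) *m hcoord x g)
                         (invmx (psi h) *m hcoord x h))
           * fpsX _ (enum_rank a))
  + 2%:R * (\sum_e fpsC _ (bform (hcoord x (e1 P e)) (hcoord x (e2 P e)))).

(** The real vector x, with entries seen in R_X. *)
Definition embed (x : 'cV[R]_ncoord) : 'cV[RXG]_ncoord :=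
  map_mx (fun r => fpsC _ r%:C) x.

Definition is_form_matrix (q : 'cV[R]_ncoord -> RXG) (M : 'M[RXG]_ncoord) : Prop :=
  M^T = M /\ forall x, q x = ((embed x)^T *m M *m embed x) 0 0.

Lemma embed_delta i : embed (delta_mx i 0) = delta_mx i 0.
Proof. by apply/matrixP => k l; rewrite !mxE; case: (_ && _). Qed.

Lemma embedD x y : embed (x + y) = embed x + embed y.
Proof.
apply/matrixP => k l; rewrite !mxE; apply: fpsP => m.
by rewrite fps_coefD !fps_coefC rmorphD; case: (m == _); rewrite ?addr0.
Qed.

Lemma is_form_matrix_uniq q M M' :
  is_form_matrix q M -> is_form_matrix q M' -> M = M'.
Proof.
move=> [sM qM] [sM' qM'].
have bE (A : 'M[RXG]_ncoord) i j :
    ((delta_mx i 0 : 'cV_ncoord)^T *m A *m (delta_mx j 0 : 'cV_ncoord)) 0 0 = A i j.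
  by rewrite trmx_delta -rowE -colE !mxE.
have diag i : M i i = M' i i.
  by have := qM (delta_mx i 0); rewrite qM' embed_delta !bE.
apply/matrixP => i j.
have sym (A : 'M[RXG]_ncoord) : A^T = A -> A j i = A i j.
  by move=> sA; rewrite -[in RHS]sA mxE.
have := qM (delta_mx i 0 + delta_mx j 0); rewrite qM' embedD !embed_delta.
have expand (A : 'M[RXG]_ncoord) : A^T = A ->
    ((delta_mx i 0 + delta_mx j 0 : 'cV_ncoord)^T *m A *m
     (delta_mx i 0 + delta_mx j 0 : 'cV_ncoord)) 0 0 =
    A i i + A j j + (A i j + A i j).
  move=> sA; rewrite [(_ + _)^T]linearD /= !mulmxDl !mulmxDr.
  rewrite [LHS]mxE [X in X + _]mxE [X in _ + X]mxE !bE (sym _ sA).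
  by rewrite -!addrA; congr (_ + _); rewrite [in RHS]addrC -!addrA.
rewrite !expand // !diag => /addrI E; apply: fpsP => m.
have := congr1 (fun s => fps_coef s m) E.
rewrite !fps_coefD -!mulr2n => /eqP; by rewrite eqrMn2r //= => /eqP ->.
Qed.

End Evaluation.

(* Main.v *)
Require Import Defs.
From HB Require Import structures.
From mathcomp Require Import all_boot all_order all_fingroup all_algebra.
From mathcomp Require Import boolp reals complex ssrcomplements mpoly ring zify.
Import Order.TTheory GRing.Theory Num.Theory.

(** The generating series is a Gaussian integral, and the theorem is Wick's
    formula for it.

    Write D_e for the differential operator of the edge e, A for the symmetric
    scalar matrix of the quadratic form in the derivatives given by
    2 * sum_e D_e, and L for the linear functional on polynomials that sends p
    to the constant term of exp (sum_e D_e) p.  It is determined by L 1 = 1 and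
    the contraction rule L (x_i p) = sum_j A_ij L (d_j p).  Let Y_a be the
    quadratic polynomial attached to the angle a, with matrix B_a / 2, and let
    B = sum_a X_a B_a.

    Each vertex polynomial is a product of powers of the Y_a ([prod_vertex_poly]).
    If p has degree c_e in the variables of either half of every edge e, Euler's
    identity gives c_e L(p) = L(D_e p); iterating it down to a constant
    identifies L(p) with the evaluation of p up to the factor prod_e c_e!
    ([contraction_evaluation]), while L(p) = 0 as soon as the degrees of p in the
    two halves of some edge differ ([contraction_neq_degree]).  The exponents of
    the X_a for which all these degrees agree are exactly those coming from an
    admissible coloring, and the coloring is recovered from them.  As the signs
    of a planar presentation are all 1, this shows that
    Z = L (exp (sum_a X_a Y_a)) ([gen_seriesE]).

    It remains to see that F = L (exp Y) satisfies F^2 det (1 - A B) = 1, which is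
    [gaussian_det].  Let G_ij = L (x_i x_j exp Y) and let t be the derivation of
    the ring of power series that multiplies a monomial by its degree.  The
    contraction rule yields G = F A + A B G ([schwinger_dyson]), homogeneity
    yields 2 t(F) = tr (B G) ([euler_expectation]), and Jacobi's formula yields
    t(det N) = tr (adj N t(N)) ([derivation_det]).  For N = 1 - A B the first two
    give 2 t(F) det N = F tr (B adj N A) and the third t(det N) = - tr (adj N A B),
    so that t(F^2 det N) = 0, and F^2 det N equals its constant term 1.

    Finally the matrix of the form Q is M = i (A - B).  Since A^2 = 1 this is
    i A (1 - A B), and det (i A) = 1 ([det_contr_mx]), so det M = det (1 - A B). *)

Set Implicit Arguments.
Unset Strict Implicit.
Unset Printing Implicit Defensive.
Local Open Scope ring_scope.

(** * Derivations of commutative rings *)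

Section Derivation.
Variables (R : comNzRingType) (D : {additive R -> R}).
Hypothesis DM : forall a b, D (a * b) = D a * b + a * D b.

Lemma derivation1 : D 1 = 0.
Proof. by have /eqP := DM 1 1; rewrite !mul1r mulr1 eq_sym -subr_eq0 addrK => /eqP. Qed.

Lemma derivation_prod (I : finType) (F : I -> R) :
  D (\prod_i F i) = \sum_i D (F i) * \prod_(j | j != i) F j.
Proof.
have key r : uniq r -> D (\prod_(i <- r) F i) =
    \sum_(i <- r) D (F i) * \prod_(j <- r | j != i) F j.
  elim: r => [|x r IH] /=; first by rewrite !big_nil derivation1.
  case/andP=> xr ur; rewrite !big_cons DM IH // eqxx /=; congr (_ * _ + _).
    rewrite [RHS]big_seq_cond [LHS]big_seq_cond; apply: eq_bigl => j.
    by rewrite andbT; case jr: (j \in r) => //=; apply/esym; apply: contraNneq xr => <-.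
  rewrite big_distrr /= big_seq [RHS]big_seq; apply: eq_bigr => i ir.
  have xi : x != i by apply: contraNneq xr => ->.
  by rewrite big_cons xi mulrCA.
by rewrite key ?index_enum_uniq.
Qed.

(** Jacobi's formula.  By the Leibniz rule the derivative of the determinant is
    the sum over i of the determinant in which row i has been differentiated;
    expanding the latter along that row produces the cofactors of M. *)
Lemma derivation_det n (M : 'M[R]_n) : D (\det M) = \tr (\adj M *m map_mx D M).
Proof.
pose M' i := \matrix_(k, l) if k == i then D (M k l) else M k l.
have -> : D (\det M) = \sum_i \det (M' i).
  rewrite raddf_sum exchange_big /=; apply: eq_bigr => s _.
  rewrite DM [D _](_ : _ = 0) ?mul0r ?add0r; last first.
    case: (odd_perm s); rewrite ?expr1 ?expr0 ?raddfN derivation1 ?oppr0 //.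
  rewrite derivation_prod -mulr_sumr; congr (_ * _); apply: eq_bigr => i _.
  rewrite [RHS](bigD1 i) //= !mxE eqxx; congr (_ * _).
  by apply: eq_bigr => j /negPf ji; rewrite mxE ji.
rewrite mxtrace_mulC; apply: eq_bigr => i _.
rewrite (expand_det_row _ i) mxE; apply: eq_bigr => j _.
rewrite !mxE eqxx; congr (_ * (_ * \det _)).
by apply/matrixP => k l; rewrite !mxE eq_sym (negPf (neq_lift _ _)).
Qed.

End Derivation.

(** * Formal power series *)

Section Fps.
Variables (n : nat) (C : comNzRingType).
Local Notation S := (fps n C).
Implicit Types (s t : S) (m : 'X_{1..n}) (a : C) (i : 'I_n).

Lemma fps_coef_sum (I : Type) (r : seq I) (Q : pred I) (F : I -> S) m :
  fps_coef (\sum_(j <- r | Q j) F j) m = \sum_(j <- r | Q j) fps_coef (F j) m.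
Proof.
by apply: (big_morph (fun s => fps_coef s m)) => [s t|];
  rewrite ?fps_coefD ?fps_coef0.
Qed.

Lemma fps_coefCM a s m : fps_coef (fpsC n a * s) m = a * fps_coef s m.
Proof.
have md := ltnSn (mdeg m).
rewrite [LHS](fps_mulE _ _ md) -[in RHS](fps_truncE s md) -mcoeffCM.
apply: (mcoeffM_low md) => // k kd.
by rewrite fps_truncE // fps_coefC mcoeffC; case: (k == _); rewrite ?mulr1 ?mulr0.
Qed.

Lemma fps_coefXM i s m : fps_coef (fpsX C i * s) m =
  if (0 < m i)%N then fps_coef s (m - U_(i))%MM else 0.
Proof.
have md := ltnSn (mdeg m).
rewrite [LHS](fps_mulE _ _ md).
rewrite (@mcoeffM_low _ _ _ _ 'X_i _ (fps_trunc (mdeg m).+1 s) _ md) //; last first.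
  by move=> k kd; rewrite fps_truncE //= mcoeffX eq_sym.
rewrite mulrC; case: ifP => mi.
  have le : (U_(i) <= m)%MM.
    by apply/mnm_lepP => j; rewrite mnm1E; case: eqP => [<-|].
  transitivity (fps_trunc (mdeg m).+1 s * 'X_[U_(i)])@_((m - U_(i))%MM + U_(i)).
    by rewrite submK.
  rewrite addmC mcoeffMX fps_truncE //.
  by apply: leq_ltn_trans (mdegB _ _) _.
apply: memN_msupp_eq0; apply/negP => /(@msuppM_le _ _ _ _ _) /allpairsP[[k1 k2] /= [_]].
rewrite msuppX inE => /eqP -> E; move: mi; rewrite E mnmDE mnm1E eqxx.
by rewrite addn1.
Qed.

Fact fpsC_is_additive : additive (@fpsC n C).
Proof.
move=> a b; apply: fpsP => m; rewrite fps_coefD fps_coefN !fps_coefC.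
by case: eqP; rewrite ?subr0.
Qed.
HB.instance Definition _ := GRing.isZmodMorphism.Build C S (@fpsC n C) fpsC_is_additive.
Fact fpsC_is_multiplicative : multiplicative (@fpsC n C).
Proof.
split=> [a b|] //; apply: fpsP => m.
by rewrite fps_coefCM !fps_coefC; case: eqP; rewrite ?mulr0.
Qed.
HB.instance Definition _ := GRing.isMultiplicative.Build C S (@fpsC n C) fpsC_is_multiplicative.

Definition fps_const s : C := fps_coef s 0%MM.

Fact fps_const_is_additive : additive fps_const.
Proof. by move=> s t; rewrite /fps_const fps_coefD fps_coefN. Qed.
HB.instance Definition _ :=
  GRing.isZmodMorphism.Build S C fps_const fps_const_is_additive.
Fact fps_const_is_multiplicative : multiplicative fps_const.
Proof.
split=> [s t|]; last by rewrite /fps_const fps_coef1 eqxx.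
have md : (mdeg (0%MM : 'X_{1..n}) < 1)%N by rewrite mdeg0.
rewrite /fps_const [LHS](fps_mulE _ _ md).
have := rmorphM (mcoeff 0%MM) (fps_trunc 1 s) (fps_trunc 1 t).
by rewrite /= !fps_truncE.
Qed.
HB.instance Definition _ :=
  GRing.isMultiplicative.Build S C fps_const fps_const_is_multiplicative.

(** The Euler operator, i.e. the sum of the X_i d/dX_i. *)
Definition fps_euler s : S := Fps (fun m => (mdeg m)%:R * fps_coef s m).

Fact fps_euler_is_additive : additive fps_euler.
Proof.
by move=> s t; apply: fpsP => m /=; rewrite !fps_coefD !fps_coefN /= mulrDr mulrN.
Qed.
HB.instance Definition _ := GRing.isZmodMorphism.Build S S fps_euler fps_euler_is_additive.

Lemma fps_eulerM s t : fps_euler (s * t) = fps_euler s * t + s * fps_euler t.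
Proof.
apply: fpsP => m; rewrite fps_coefD /= !fps_coefM mulr_sumr -big_split /=.
apply: eq_bigr => -[k1 k2] /= /eqP Em.
have Ed : (mdeg m)%:R = (mdeg k1)%:R + (mdeg k2)%:R :> C.
  by rewrite -natrD -mdegD -Em.
by rewrite Ed mulrDl mulrA; congr (_ + _); rewrite mulrCA.
Qed.

Lemma fps_eulerC a : fps_euler (fpsC n a) = 0.
Proof.
apply: fpsP => m; rewrite fps_coef0 /= fps_coefC -mdeg_eq0.
by case: (mdeg m) => [|d]; rewrite ?mul0r ?mulr0.
Qed.

Lemma fps_eulerX i : fps_euler (fpsX C i) = fpsX C i.
Proof.
by apply: fpsP => m /=; case: eqP => [->|]; rewrite ?mdeg1 ?mulr1 ?mulr0.
Qed.

End Fps.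

(** A coefficient of degree d gets multiplied by d, which is nonzero in
    characteristic 0 unless d = 0.  This plays the part of the uniqueness of
    solutions of a differential equation with given initial value. *)
Lemma fps_euler_eq0 n (C : numDomainType) (s : fps n C) :
  fps_euler s = 0 -> s = fpsC n (fps_coef s 0%MM).
Proof.
move=> s0; apply: fpsP => m; rewrite fps_coefC.
case: eqP => [-> //|m0]; have := congr1 (fun t => fps_coef t m) s0.
rewrite fps_coef0 /= => /eqP; rewrite mulf_eq0 pnatr_eq0 mdeg_eq0.
by case: eqP => //= _ /eqP.
Qed.

(** * Divided powers of polynomials *)

Lemma mderivXU (C : comNzRingType) n (i j : 'I_n) :
  ('X_i : {mpoly C[n]})^`M(j) = (i == j)%:R.
Proof.
rewrite mderivX mnm1E; case: eqP => [->|]; last by rewrite scale0r.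
by rewrite -{1}[U_(j)%MM]add0m addmK mpolyX0 scale1r.
Qed.

Section DividedPower.
Variables (C : numFieldType) (n k : nat) (Y : 'I_k -> {mpoly C[n]}).
Implicit Types (m : 'X_{1..k}).

(** The coefficient of X^m in exp (sum_a X_a Y_a). *)
Definition divpow m : {mpoly C[n]} :=
  (\prod_a (m a)`!%:R)^-1 *: \prod_a Y a ^+ m a.

Lemma divpow0 : divpow 0 = 1.
Proof.
rewrite /divpow !big1 ?invr1 ?scale1r // => a _; first by rewrite mnm0E expr0.
by rewrite mnm0E.
Qed.

Lemma prod_mnmB1 (T : comPzRingType) (f : 'I_k -> nat -> T) m a :
  \prod_b f b ((m - U_(a))%MM b) =
  f a (m a).-1 * \prod_(b | b != a) f b (m b).
Proof.
rewrite (bigD1 a) //= mnmBE mnm1E eqxx subn1; congr (_ * _).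
by apply: eq_bigr => b ba; rewrite mnmBE mnm1E eq_sym (negPf ba) subn0.
Qed.

Lemma divpow_coefB1 m a : (0 < m a)%N ->
  (m a)%:R * (\prod_b (m b)`!%:R)^-1 =
  (\prod_b ((m - U_(a))%MM b)`!%:R)^-1 :> C.
Proof.
move=> ma; rewrite (prod_mnmB1 (fun _ d => d`!%:R)) (bigD1 a) //= !invfM mulrA.
rewrite -{1 2}(prednK ma) factS natrM invfM mulrA divff ?mul1r //.
by rewrite pnatr_eq0.
Qed.

Lemma divpow_step m a : (0 < m a)%N ->
  (m a)%:R *: divpow m = Y a * divpow (m - U_(a)).
Proof.
move=> ma; rewrite /divpow -scalerAr scalerA divpow_coefB1 //; congr (_ *: _).
rewrite (prod_mnmB1 (fun b d => Y b ^+ d)) (bigD1 a) //=.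
by rewrite mulrA -exprS prednK.
Qed.

(** X-homogeneity of the exponential: the Euler operator multiplies exp Y by
    Y = sum_a X_a Y_a. *)
Lemma divpow_euler m :
  (mdeg m)%:R *: divpow m = \sum_(a | (0 < m a)%N) Y a * divpow (m - U_(a)).
Proof.
rewrite mdegE natr_sum scaler_suml [RHS]big_mkcond; apply: eq_bigr => a _.
by case: ifPn => [/divpow_step //|]; rewrite -eqn0Ngt => /eqP ->; rewrite scale0r.
Qed.

(** The chain rule for exp Y, coefficient by coefficient. *)
Lemma mderiv_divpow i m : (divpow m)^`M(i) =
  \sum_(a | (0 < m a)%N) (Y a)^`M(i) * divpow (m - U_(a)).
Proof.
have expD (p : {mpoly C[n]}) d : (p ^+ d)^`M(i) = d%:R *: (p^`M(i) * p ^+ d.-1).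
  elim: d => [|d IH]; first by rewrite expr0 scale0r -mpolyC1 mderivC.
  rewrite exprS mderivM IH -scalerAr -[X in X + _]scale1r mulrCA.
  by case: d {IH} => [|d]; rewrite ?scale0r ?addr0 //= -exprS -scalerDl nat1r.
rewrite mderivZ (derivation_prod (D := mderiv i)); last by move=> p q; apply: mderivM.
rewrite scaler_sumr [RHS]big_mkcond; apply: eq_bigr => a _.
rewrite [X in X * _]expD; case: ifPn => [ma|]; last first.
  by rewrite -eqn0Ngt => /eqP ->; rewrite scale0r mul0r scaler0.
rewrite /divpow (prod_mnmB1 (fun b d => Y b ^+ d)) -divpow_coefB1 //.
by rewrite -!scalerAl -!scalerAr scalerA mulrC mulrA.
Qed.

End DividedPower.

(** * Quadratic polynomials and symmetric matrices *)

Definition sym_mul (C : comNzRingType) n (l r : 'rV[C]_n) : 'M[C]_n :=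
  l^T *m r + r^T *m l.

Section QuadraticPolynomial.
Variables (C : numFieldType) (n : nat).
Implicit Types (M : 'M[C]_n) (l r : 'rV[C]_n).

Definition quad_poly M : {mpoly C[n]} := \sum_i \sum_j M i j *: ('X_i * 'X_j).

Fact quad_poly_is_additive : additive quad_poly.
Proof.
move=> M N; rewrite -sumrB; apply: eq_bigr => i _; rewrite -sumrB.
by apply: eq_bigr => j _; rewrite !mxE scalerBl.
Qed.
HB.instance Definition _ :=
  GRing.isZmodMorphism.Build 'M[C]_n {mpoly C[n]} quad_poly quad_poly_is_additive.

Definition lin_poly l : {mpoly C[n]} := \sum_j l 0 j *: 'X_j.

Fact lin_poly_is_linear : linear lin_poly.
Proof.
move=> a l r; rewrite scaler_sumr -big_split; apply: eq_bigr => j _ /=.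
by rewrite !mxE scalerDl scalerA.
Qed.
HB.instance Definition _ :=
  GRing.isLinear.Build C 'rV[C]_n {mpoly C[n]} _ lin_poly lin_poly_is_linear.

Lemma lin_poly_delta i : lin_poly (delta_mx 0 i) = 'X_i.
Proof.
rewrite /lin_poly (bigD1 i) //= mxE !eqxx scale1r big1 ?addr0 // => j ji.
by rewrite mxE (negPf ji) scale0r.
Qed.

Lemma quad_poly_mul l r : quad_poly (l^T *m r) = lin_poly l * lin_poly r.
Proof.
rewrite mulr_suml; apply: eq_bigr => i _; rewrite mulr_sumr.
apply: eq_bigr => j _; rewrite !mxE big_ord1 !mxE.
by rewrite -scalerAl -scalerAr scalerA.
Qed.

Lemma trmx_sym_mulB l r l' r' :
  (sym_mul l r - sym_mul l' r')^T = sym_mul l r - sym_mul l' r'.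
Proof.
have sym u v : (sym_mul u v)^T = sym_mul u v.
  by rewrite raddfD /= !trmx_mul !trmxK addrC.
by rewrite raddfB /= !sym.
Qed.

Lemma quad_poly_sym_mulB l r l' r' :
  quad_poly (sym_mul l r - sym_mul l' r') =
  (lin_poly l * lin_poly r - lin_poly l' * lin_poly r') *+ 2.
Proof.
have sym u v : quad_poly (sym_mul u v) = (lin_poly u * lin_poly v) *+ 2.
  by rewrite raddfD /= !quad_poly_mul [lin_poly v * _]mulrC.
by rewrite raddfB /= !sym mulrnBl.
Qed.

Lemma mderiv_quad_poly M i : M^T = M ->
  (quad_poly M)^`M(i) = (\sum_j M i j *: 'X_j) *+ 2.
Proof.
move=> sM; have MC k j : M k j = M j k by rewrite -[in LHS]sM mxE.
rewrite raddf_sum mulr2n /=.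
have -> : \sum_j M i j *: 'X_j =
    \sum_k \sum_j M k j *: ((i == k)%:R * 'X_j) :> {mpoly C[n]}.
  rewrite [RHS](bigD1 i) //= eqxx [X in _ + X]big1 ?addr0 => [|k ki].
    by apply: eq_bigr => j _; rewrite mul1r.
  by rewrite big1 // => j _; rewrite eq_sym (negPf ki) mul0r scaler0.
rewrite {2}exchange_big -big_split; apply: eq_bigr => k _ /=.
rewrite raddf_sum -big_split; apply: eq_bigr => j _ /=.
rewrite mderivZ mderivM !mderivXU ![_ == i]eq_sym.
by rewrite scalerDr [M j k]MC ['X_k * _]mulrC.
Qed.

End QuadraticPolynomial.

(** * The Gaussian determinant formula *)

Section Gaussian.
Variables (C : numFieldType) (n k : nat) (A : 'M[C]_n).
Variable (L : {scalar {mpoly C[n]}}).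
Hypothesis L1 : L 1 = 1.
Hypothesis LX : forall i p, L ('X_i * p) = \sum_j A i j * L p^`M(j).
Variables (Y : 'I_k -> {mpoly C[n]}) (B : 'I_k -> 'M[C]_n).
Hypothesis Bsym : forall a, (B a)^T = B a.
Hypothesis Yquad : forall a, Y a *+ 2 = quad_poly (B a).

Let Yderiv a i : (Y a)^`M(i) = \sum_j B a i j *: 'X_j.
Proof.
have two : 2%:R != 0 :> C by rewrite pnatr_eq0.
apply: (scalerI two); rewrite !scaler_nat -mderiv_quad_poly //.
by rewrite -Yquad raddfMn.
Qed.

Definition expectation : fps k C := Fps (fun m => L (divpow Y m)).
Definition second_moment : 'M[fps k C]_n :=
  \matrix_(i, j) Fps (fun m => L ('X_i * 'X_j * divpow Y m)).
Definition coupling : 'M[fps k C]_n :=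
  \matrix_(i, j) \sum_a fpsC k (B a i j) * fpsX C a.

Local Notation F := expectation.
Local Notation G := second_moment.
Local Notation BX := coupling.
Local Notation AX := (map_mx (@fpsC k C) A).

(** Contracting x_i with the other factors of x_i x_j exp Y: the contraction
    with x_j gives F A, the one with exp Y brings down a derivative of Y, that
    is a row of the matrix B applied to x. *)
Lemma schwinger_dyson : G = F *: AX + AX *m BX *m G.
Proof.
apply/matrixP => i j; rewrite -mulmxA !mxE; apply: fpsP => m.
rewrite fps_coefD [F * _]mulrC fps_coefCM /= -mulrA LX fps_coef_sum /=.
have -> : A i j * L (divpow Y m) = \sum_l A i l * L ((l == j)%:R *: divpow Y m).
  rewrite (bigD1 j) //= eqxx scale1r big1 ?addr0 // => l /negPf ->.
  by rewrite scale0r linear0 mulr0.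
rewrite -big_split; apply: eq_bigr => l _ /=.
rewrite !mxE fps_coefCM -mulrDr mderivM linearD; congr (_ * (_ + _)).
  congr (L _); rewrite mderivXU eq_sym.
  by case: eqP => _; rewrite ?scale1r ?mul1r // scale0r mul0r.
rewrite mderiv_divpow mulr_sumr linear_sum fps_coef_sum.
under [RHS]eq_bigr => r _ do rewrite mxE mulr_suml fps_coef_sum.
rewrite exchange_big big_mkcond; apply: eq_bigr => a _ /=.
under [RHS]eq_bigr => r _ do rewrite -mulrA fps_coefCM fps_coefXM mxE /=.
case: ifP => ma; last by rewrite big1 // => r _; rewrite mulr0.
rewrite Yderiv mulr_suml mulr_sumr linear_sum; apply: eq_bigr => r _ /=.
by rewrite -scalerAl -scalerAr linearZ /= mulrCA mulrA.
Qed.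

Lemma euler_expectation : fps_euler F *+ 2 = \tr (BX *m G).
Proof.
apply: fpsP => m; rewrite fps_coef_sum mulr2n fps_coefD /= -mulr2n.
rewrite -linearZ /= -raddfMn divpow_euler -sumrMnl raddf_sum /=.
under [RHS]eq_bigr => i _.
  rewrite mxE fps_coef_sum.
  under eq_bigr => j _ do rewrite !mxE mulr_suml fps_coef_sum.
  rewrite exchange_big /=.
  over.
rewrite exchange_big big_mkcond; apply: eq_bigr => a _ /=.
under [RHS]eq_bigr => i _.
  under eq_bigr => j _ do rewrite -mulrA fps_coefCM fps_coefXM /=.
  over.
case: ifP => ma; last by rewrite big1 // => i _; rewrite big1 // => r _; rewrite mulr0.
rewrite -mulrnAl Yquad mulr_suml linear_sum; apply: eq_bigr => i _.
rewrite mulr_suml linear_sum; apply: eq_bigr => j _ /=.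
by rewrite -scalerAl linearZ /= ['X_i * _]mulrC.
Qed.

Lemma euler_coupling : map_mx (@fps_euler k C) BX = BX.
Proof.
apply/matrixP => i j; rewrite !mxE raddf_sum; apply: eq_bigr => a _.
by rewrite [LHS]fps_eulerM fps_eulerC fps_eulerX mul0r add0r.
Qed.

(** The determinant is not inverted: multiplying [schwinger_dyson] by the
    adjugate of N = 1 - A B gives det N G = F adj N A, which is all that the
    computation of the derivative of F^2 det N requires. *)
Lemma gaussian_det : fps_coef F 0%MM = 1 /\ F ^+ 2 * \det (1%:M - AX *m BX) = 1.
Proof.
have F0 : fps_coef F 0%MM = 1 by rewrite /= divpow0.
split=> //; set N := 1%:M - AX *m BX; set d := \det N.
have dG : d *: G = F *: (\adj N *m AX).
  rewrite -mul_scalar_mx -mul_adj_mx -mulmxA mulmxBl mul1mx.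
  by rewrite {1}schwinger_dyson addrK -scalemxAr.
have eN : map_mx (@fps_euler k C) N = - (AX *m BX).
  rewrite map_mxB [map_mx _ 1%:M](_ : _ = 0) ?sub0r; last first.
    by apply/matrixP => i j; rewrite !mxE raddfMn (derivation1 (@fps_eulerM k C)) mul0rn.
  congr (- _).
  apply/matrixP => i j; rewrite !mxE raddf_sum; apply: eq_bigr => l _.
  rewrite [LHS]fps_eulerM !mxE fps_eulerC mul0r add0r.
  by have /matrixP/(_ l j) := euler_coupling; rewrite !mxE => ->.
have ed : fps_euler d = - \tr (BX *m \adj N *m AX).
  rewrite (derivation_det (@fps_eulerM k C)) eN mulmxN raddfN /=.
  by rewrite mulmxA mxtrace_mulC mulmxA.
(* Both terms of the Leibniz rule reduce to F^2 times the trace of B adj N A. *)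
have e0 : fps_euler (F ^+ 2 * d) = 0.
  rewrite fps_eulerM expr2 fps_eulerM ed [F * fps_euler F]mulrC -mulr2n.
  rewrite -mulrnAl euler_expectation mulrN -mulmxA.
  rewrite -[_ * F * d]mulrA [F * d]mulrC mulrA [_ * d]mulrC -mxtraceZ scalemxAr dG.
  by rewrite -scalemxAr mxtraceZ mulrAC mulmxA subrr.
rewrite (fps_euler_eq0 e0) -[RHS]/(fpsC k 1); congr fpsC.
rewrite -[fps_coef _ _]/(fps_const (F ^+ 2 * d)) rmorphM rmorphXn /=.
rewrite divpow0 L1 expr1n mul1r -det_map_mx.
rewrite map_mxB map_mx1 map_mxM [map_mx _ BX](_ : _ = 0); last first.
  apply/matrixP => i j; rewrite !mxE rmorph_sum big1 // => a _.
  rewrite rmorphM /= /fps_const /= (_ : 0%MM == U_(a)%MM = false) ?mulr0 //.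
  by apply/eqP => /(congr1 (@mdeg k)); rewrite mdeg0 mdeg1.
by rewrite mulmx0 subr0 det1.
Qed.
End Gaussian.

(** * A contraction functional on polynomials *)

Section Pairing.
Variables (C : numFieldType) (n : nat) (sigma : 'I_n -> 'I_n) (s : 'I_n -> C).
Hypothesis sigmaK : involutive sigma.
Hypothesis sigma_neq : forall i, sigma i != i.
Hypothesis s_sigma : forall i, s (sigma i) = s i.
Implicit Types (m : 'X_{1..n}) (p : {mpoly C[n]}).

(** When the matrix A has entries s_i at (i, sigma i) and 0 elsewhere, the
    variables x_i and x_(sigma i) can only be contracted with each other, so
    the functional is a product over the pairs {i, sigma i}: a monomial
    contributes only if both variables of each pair have the same exponent d,
    and there are then d! ways of matching them.  The condition i < sigma i
    selects one index in each pair. *)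
Definition moment m : C :=
  if [forall i, m i == m (sigma i)]
  then \prod_(i < n | (i < sigma i)%N) ((m i)`!%:R * s i ^+ m i) else 0.

Lemma moment_pair i m :
  moment (U_(i) + (U_(sigma i) + m)) = s i * (m (sigma i)).+1%:R * moment m.
Proof.
have U j : (U_(i) + (U_(sigma i) + m))%MM j =
    ((i == j) + ((sigma i == j) + m j))%N by rewrite !mnmDE !mnm1E.
have sw j : (sigma i == sigma j) = (i == j) by rewrite (can_eq sigmaK).
have sw' j : (i == sigma j) = (sigma i == j) by rewrite -[LHS](can_eq sigmaK) sigmaK.
rewrite /moment [X in if X then _ else _](_ : _ = [forall j, m j == m (sigma j)]); last first.
  by apply: eq_forallb => j; rewrite !U sw sw' addnCA !eqn_add2l.
case: ifP => [/forallP sym|_]; last by rewrite mulr0.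
pose r := if (i < sigma i)%N then i else sigma i.
have rP : (r < sigma r)%N.
  rewrite /r; case: (ltnP i (sigma i)) => // le; rewrite sigmaK ltn_neqAle le andbT.
  by rewrite (inj_eq val_inj).
have sr : s r = s i by rewrite /r; case: ifP.
have mr : m r = m (sigma i) by rewrite /r; case: ifP => // _; apply/eqP.
rewrite (bigD1 r) //= [in RHS](bigD1 r) //= !mulrA; congr (_ * _); last first.
  apply: eq_bigr => j /andP[lt jr]; rewrite U.
  have /negPf-> : i != j.
    by apply: contraNneq jr => ij; rewrite /r ij lt.
  have /negPf-> // : sigma i != j.
  apply: contraNneq jr => ij; rewrite /r -ij sigmaK in lt *.
  by rewrite ltnNge ltnW.
rewrite U -mr sr [(_ + (_ + _))%N](_ : _ = (m r).+1); last first.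
  rewrite /r; case: ifP => _; rewrite eqxx ?(negPf (sigma_neq i)) //.
  by rewrite eq_sym (negPf (sigma_neq i)).
by rewrite factS natrM exprS; ring.
Qed.

Lemma moment_step i m :
  moment (U_(i) + m) = s i * (m (sigma i))%:R * moment (m - U_(sigma i)).
Proof.
case: (posnP (m (sigma i))) => [m0|mpos].
  rewrite m0 mulr0 mul0r /moment; case: forallP => // /(_ i).
  rewrite !mnmDE !mnm1E eqxx m0 eq_sym.
  by rewrite (eq_sym i) (negPf (sigma_neq i)).
have le : (U_(sigma i) <= m)%MM.
  by apply/mnm_lepP => j; rewrite mnm1E; case: eqP => [<-|].
rewrite -{1}(submK le) [X in (_ + X)%MM]addmC moment_pair.
by rewrite mnmBE mnm1E eqxx subn1 prednK.
Qed.

Definition pairing p : C := \sum_(m <- msupp p) p@_m * moment m.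

Lemma pairingwE k p : (msize p <= k)%N ->
  pairing p = \sum_(m : 'X_{1..n < k}) p@_m * moment m.
Proof.
pose I : subFinType _ := 'X_{1..n < k}.
move=> le_pk; rewrite /pairing (big_mksub I) /=; first last.
- by move=> x /msize_mdeg_lt/leq_trans/(_ le_pk).
- by rewrite msupp_uniq.
by rewrite big_rmcond //= => j /memN_msupp_eq0 ->; rewrite mul0r.
Qed.

Fact pairing_is_scalar : scalar pairing.
Proof.
move=> c p q; pose k := maxn (msize (c *: p + q)) (maxn (msize p) (msize q)).
rewrite !(@pairingwE k) ?leq_max ?leqnn ?orbT // mulr_sumr -big_split /=.
by apply: eq_bigr => m _; rewrite mcoeffD mcoeffZ mulrDl mulrA.
Qed.
HB.instance Definition _ :=
  GRing.isLinear.Build C {mpoly C[n]} C _ pairing pairing_is_scalar.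

Lemma pairingX m : pairing 'X_[m] = moment m.
Proof. by rewrite /pairing msuppX big_seq1 mcoeffX eqxx mul1r. Qed.

Lemma pairing1 : pairing 1 = 1.
Proof.
rewrite -mpolyX0 pairingX /moment ifT; last by apply/forallP => i; rewrite !mnm0E.
by rewrite big1 // => i _; rewrite mnm0E mulr1.
Qed.

(** The contraction rule. *)
Lemma pairing_mulX i p : pairing ('X_i * p) = s i * pairing p^`M(sigma i).
Proof.
rewrite [p in LHS]mpolyE [p in RHS]mpolyE mulr_sumr.
rewrite (raddf_sum (mderiv (sigma i))) !raddf_sum mulr_sumr /=.
apply: eq_bigr => m _; rewrite -scalerAr -mpolyXD mderivZ mderivX !linearZ /= !pairingX moment_step.
by ring.
Qed.

End Pairing.

(** * Monomial matrices and values of quadratic forms *)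

Section MonomialMatrix.
Variables (C : comNzRingType) (n : nat).

Definition monomial_mx (s : 'I_n -> C) (f : 'I_n -> 'I_n) : 'M[C]_n :=
  \matrix_(i, j) (s i *+ (j == f i)).

Lemma mul_monomial_mx p s f (M : 'M[C]_(n, p)) i j :
  (monomial_mx s f *m M) i j = s i * M (f i) j.
Proof.
rewrite mxE (bigD1 (f i)) //= mxE eqxx big1 ?addr0 // => k /negPf kf.
by rewrite mxE kf mul0r.
Qed.

Lemma monomial_mxM s t f g :
  monomial_mx s f *m monomial_mx t g = monomial_mx (fun i => s i * t (f i)) (g \o f).
Proof. by apply/matrixP => i j; rewrite mul_monomial_mx !mxE mulrnAr. Qed.

Lemma monomial_mx_scalar s f a : f =1 id -> s =1 (fun=> a) -> monomial_mx s f = a%:M.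
Proof. by move=> f1 sa; apply/matrixP => i j; rewrite !mxE f1 sa eq_sym. Qed.

End MonomialMatrix.

Section QuadraticValue.
Variables (C : comNzRingType) (n : nat).
Implicit Types (v : 'cV[C]_n) (M : 'M[C]_n) (l r : 'rV[C]_n).

Definition quad_value v M : C := (v^T *m M *m v) 0 0.

Fact quad_value_is_scalar v : scalar (quad_value v).
Proof.
by move=> a M M'; rewrite /quad_value mulmxDr mulmxDl -scalemxAr -scalemxAl !mxE.
Qed.
HB.instance Definition _ v :=
  GRing.isLinear.Build C 'M[C]_n C _ (quad_value v) (quad_value_is_scalar v).

Lemma quad_value_sym_mulB v l r l' r' :
  quad_value v (sym_mul l r - sym_mul l' r') =
  2%:R * ((l *m v) 0 0 * (r *m v) 0 0 - (l' *m v) 0 0 * (r' *m v) 0 0).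
Proof.
have rank1 (a b : 'rV[C]_n) : quad_value v (a^T *m b) = (a *m v) 0 0 * (b *m v) 0 0.
  rewrite /quad_value mulmxA -trmx_mul -mulmxA [LHS]mxE big_ord1.
  by rewrite [(_^T) 0 0]mxE.
have sym a b : quad_value v (sym_mul a b) = 2%:R * ((a *m v) 0 0 * (b *m v) 0 0).
  by rewrite raddfD /= !rank1 [(b *m v) 0 0 * _]mulrC -mulr2n mulr_natl.
by rewrite raddfB /= !sym mulrBr.
Qed.

Lemma mul_delta2 (a b : C) i j v :
  ((a *: delta_mx 0 i + b *: delta_mx 0 j : 'rV_n) *m v) 0 0 = a * v i 0 + b * v j 0.
Proof. by rewrite mulmxDl -!scalemxAl -!rowE !mxE. Qed.

Lemma quad_value_monomial_mx v s f :
  quad_value v (monomial_mx s f) = \sum_i s i * v i 0 * v (f i) 0.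
Proof.
rewrite /quad_value -mulmxA mxE; apply: eq_bigr => i _.
by rewrite mul_monomial_mx mxE mulrA [v i 0 * _]mulrC.
Qed.

End QuadraticValue.

Lemma quad_value_map (C D : comNzRingType) (f : {rmorphism C -> D}) n
    (v : 'cV[C]_n) (M : 'M[C]_n) :
  quad_value (map_mx f v) (map_mx f M) = f (quad_value v M).
Proof. by rewrite /quad_value map_trmx -!map_mxM mxE. Qed.

Lemma couplingE (C : numFieldType) n k (B : 'I_k -> 'M[C]_n) :
  coupling B = \sum_a fpsX C a *: map_mx (@fpsC k C) (B a).
Proof.
apply/matrixP => i j; rewrite mxE summxE; apply: eq_bigr => a _.
by rewrite !mxE mulrC.
Qed.

(** * Colorings and exponents of angles *)

Section VertexTriples.
Variable G : trivalent_graph.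
Implicit Types (g h x y z : half_edge G) (a b : angle G) (c : edge G -> nat).

(** Forgetting the cyclic order makes the three half-edges at a vertex
    interchangeable, so that each local statement is needed for one ordering
    only. *)
Definition triple x y z : Prop :=
  [/\ x != y, x != z, y != z &
      forall g, (vtx g == vtx x) = [|| g == x, g == y | g == z]].

Lemma triple_vtx x y z : triple x y z -> vtx y = vtx x /\ vtx z = vtx x.
Proof. by case=> _ _ _ E; split; apply/eqP; rewrite E eqxx ?orbT. Qed.

Lemma triple_swapl x y z : triple x y z -> triple y x z.
Proof.
move=> T; have [vy _] := triple_vtx T; case: T => xy xz yz E.
by split; rewrite // 1?eq_sym // => g; rewrite vy E orbCA.
Qed.

Lemma triple_swapr x y z : triple x y z -> triple x z y.
Proof.
case=> xy xz yz E; split; rewrite // 1?eq_sym // => g.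
by rewrite E [(g == y) || _]orbC.
Qed.

Lemma triple_nxt h : triple h (nxt h) (nxt (nxt h)).
Proof.
have n3 : nxt (nxt h) != h.
  by apply: contraNneq (nxt_neq h) => E; rewrite -{2}(nxt3 h) E.
split; rewrite 1?eq_sym ?nxt_neq // => g.
by rewrite vtx_half !inE orbA.
Qed.

Lemma big_vertex (T : nmodType) (F : half_edge G -> T) x y z : triple x y z ->
  \sum_(g | vtx g == vtx x) F g = F x + (F y + F z).
Proof.
case=> xy xz yz E; rewrite (eq_bigl (mem [set x; y; z])); last first.
  by move=> g; rewrite E !inE orbA.
by rewrite -setUA !big_setU1 ?inE ?negb_or ?xy ?xz ?yz //= big_set1.
Qed.

Lemma big_vertex_but (T : nmodType) (F : half_edge G -> T) x y z : triple x y z ->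
  \sum_(g | (vtx g == vtx x) && (g != x)) F g = F y + F z.
Proof.
case=> xy xz yz E; rewrite (eq_bigl (mem [set y; z])); last first.
  move=> g; rewrite E !inE; case: (g =P x) => [->|_] /=; last by rewrite andbT.
  by rewrite (negPf xy) (negPf xz).
by rewrite big_setU1 ?inE //= big_set1.
Qed.

Lemma admissible_triple c x y z : admissible c -> triple x y z ->
  ~~ odd (c (edg x) + (c (edg y) + c (edg z)))%N /\
  (c (edg x) <= c (edg y) + c (edg z))%N.
Proof.
move=> /andP[/forallP /(_ (vtx x)) ev /forallP /(_ x) le] T.
by move: ev le; rewrite (big_vertex _ T) (big_vertex_but _ T).
Qed.

Lemma triple_admissible c :
  (forall x y z, triple x y z ->
    ~~ odd (c (edg x) + (c (edg y) + c (edg z)))%N /\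
    (c (edg x) <= c (edg y) + c (edg z))%N) -> admissible c.
Proof.
move=> H; apply/andP; split; [apply/forallP => v | apply/forallP => h]; last first.
  by rewrite (big_vertex_but _ (triple_nxt h)); case: (H _ _ _ (triple_nxt h)).
have [h /[!inE] /eqP <-] : exists h, h \in [set h | vtx h == v].
  by apply/card_gt0P; rewrite card_vtx.
by rewrite (big_vertex _ (triple_nxt h)); case: (H _ _ _ (triple_nxt h)).
Qed.

Lemma angle_pairP x y : x != y -> vtx x = vtx y ->
  (#|[set x; y]| == 2) &&
  [forall g in [set x; y], forall h in [set x; y], vtx g == vtx h].
Proof.
move=> xy vxy; rewrite cards2 xy /=.
apply/forall_inP => g /[!inE] ga; apply/forall_inP => h /[!inE] ha.
by case/orP: ga => /eqP->; case/orP: ha => /eqP->; rewrite ?vxy.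
Qed.

Lemma angle_ex x y z : triple x y z -> exists a, val a = [set x; y].
Proof.
move=> T; have [vy _] := triple_vtx T; case: T => xy _ _ _.
by exists (Sub [set x; y] (angle_pairP xy (esym vy))).
Qed.

Lemma angle_triple a : exists x y z, triple x y z /\ val a = [set x; y].
Proof.
case: a => A /= /andP[/cards2P[x [y [xy ->]]] /forall_inP/(_ x)].
rewrite !inE eqxx => /(_ isT) /forall_inP/(_ y); rewrite !inE eqxx orbT.
move=> /(_ isT) vxy.
have T := triple_nxt x; have [_ _ _ E] := T; move: vxy; rewrite eq_sym E.
rewrite eq_sym (negPf xy) /= => /orP[] /eqP ->.
  by exists x, (nxt x), (nxt (nxt x)).
by exists x, (nxt (nxt x)), (nxt x); split=> //; apply: triple_swapr.
Qed.

Lemma angle_color_triple c a x y z : triple x y z -> val a = [set x; y] ->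
  angle_color c a = (c (edg x) + c (edg y) - c (edg z))./2.
Proof.
move=> T Ea; have [vy vz] := triple_vtx T; have [xy xz yz E] := T.
rewrite /angle_color Ea big_setU1 ?inE //= big_set1.
suff -> : angle_compl a = [set z] by rewrite big_set1.
apply/setP => g; rewrite !inE Ea !inE negb_or.
have -> : [exists h in [set x; y], vtx h == vtx g] = (vtx g == vtx x).
  apply/exists_inP/idP => [[h]|/eqP vg]; last by exists x; rewrite ?inE ?eqxx ?vg.
  by rewrite !inE => /orP[] /eqP -> /eqP <-; rewrite ?vy.
rewrite E; case: (g =P x) => [->|_] /=; first by rewrite (negPf xz).
by case: (g =P y) => [->|_] //=; rewrite (negPf yz).
Qed.

Lemma mem_angle_triple a b x y z : triple x y z -> val a = [set x; y] ->
  val b = [set x; z] -> forall d : angle G, (x \in val d) = (d == a) || (d == b).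
Proof.
move=> T Ea Eb d; apply/idP/orP => [xd|[] /eqP ->]; last 2 first.
- by rewrite Ea !inE eqxx.
- by rewrite Eb !inE eqxx.
have [_ _ _ E] := T; have [u [v [w [T' Ed]]]] := angle_triple d.
have [vv _] := triple_vtx T'; have [uv _ _ _] := T'.
have [t xt Et] : exists2 t, x != t & val d = [set x; t] /\ vtx t = vtx x.
  move: xd; rewrite Ed !inE => /orP[] /eqP ->; first by exists v.
  by exists u; rewrite 1?eq_sym // finset.setUC.
case: Et => Et vt; move/eqP: vt; rewrite E eq_sym (negPf xt) /=.
by case/orP => /eqP tE; [left|right]; apply/eqP/val_inj; rewrite Et tE ?Ea ?Eb.
Qed.

Lemma angle_neq_triple a b x y z : triple x y z -> val a = [set x; y] ->
  val b = [set x; z] -> a != b.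
Proof.
move=> [xy _ yz _] Ea Eb; apply/eqP => /(congr1 val) /setP /(_ y).
by rewrite Ea Eb !inE eqxx orbT eq_sym (negPf xy) (negPf yz).
Qed.

Lemma big_angle_triple (T : nmodType) (F : angle G -> T) a b x y z :
  triple x y z -> val a = [set x; y] -> val b = [set x; z] ->
  \sum_(d : angle G | x \in val d) F d = F a + F b.
Proof.
move=> tr Ea Eb; rewrite (eq_bigl (mem [set a; b])); last first.
  by move=> d; rewrite (mem_angle_triple tr Ea Eb) !inE.
by rewrite big_setU1 ?inE ?(angle_neq_triple tr Ea Eb) //= big_set1.
Qed.

(** If i, j, k are the colors at a vertex, then
    (i + j - k) / 2 + (i + k - j) / 2 = i.  Hence the exponents of X^c determine
    the coloring c. *)
Lemma sum_angle_color c h : admissible c ->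
  (\sum_(a : angle G | h \in val a) angle_color c a)%N = c (edg h).
Proof.
move=> adm; have T := triple_nxt h; have T' := triple_swapr T.
have [a Ea] := angle_ex T; have [b Eb] := angle_ex T'.
rewrite (big_angle_triple _ T Ea Eb).
rewrite (angle_color_triple c T Ea) (angle_color_triple c T' Eb).
have [] := admissible_triple adm T.
have [_] := admissible_triple adm (triple_swapl T).
have [_] := admissible_triple adm (triple_swapl T').
rewrite -[(_ + _)%R]/((_ + _)%N).
move: (c _) (c _) (c _) => n1 n2 n3; lia.
Qed.

Section ColoringOfExponents.
Variables (m : angle G -> nat) (c : edge G -> nat).
Hypothesis mc : forall h, (\sum_(a : angle G | h \in val a) m a)%N = c (edg h).

Let mcE x y z a b : triple x y z -> val a = [set x; y] -> val b = [set x; z] ->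
  c (edg x) = (m a + m b)%N.
Proof. by move=> T Ea Eb; rewrite -mc (big_angle_triple _ T Ea Eb). Qed.

Let mcE3 x y z a : triple x y z -> val a = [set x; y] ->
  exists b d, [/\ c (edg x) = (m a + m b)%N, c (edg y) = (m a + m d)%N
                & c (edg z) = (m b + m d)%N].
Proof.
move=> T Ea; have T' := triple_swapl T; have T'' := triple_swapl (triple_swapr T).
have [b Eb] := angle_ex (triple_swapr T); have [d Ed] := angle_ex (triple_swapr T').
exists b, d; split; first exact: mcE T Ea Eb.
  by apply: mcE T' _ Ed; rewrite Ea finset.setUC.
by apply: mcE T'' _ _; rewrite ?Eb ?Ed finset.setUC.
Qed.

(** Conversely, three exponents a, b, d at a vertex give it the colors a + b,
    a + d, b + d, for which parity and triangle inequalities are automatic; all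
    that is needed to define a coloring is that the two values obtained for an
    edge at its two ends agree. *)
Lemma exponents_admissible : admissible c.
Proof.
apply: triple_admissible => x y z T; have [a Ea] := angle_ex T.
by have [b [d [-> -> ->]]] := mcE3 T Ea; split; lia.
Qed.

Lemma exponents_angle_color a : angle_color c a = m a.
Proof.
have [x [y [z [T Ea]]]] := angle_triple a.
have [b [d [cx cy cz]]] := mcE3 T Ea.
by rewrite (angle_color_triple c T Ea) cx cy cz; lia.
Qed.

End ColoringOfExponents.
End VertexTriples.

(** * Halves of edges and vertices in a presentation *)

Section PresentationOrder.
Variables (G : trivalent_graph) (P : presentation G).
Implicit Types (g h x y z : half_edge G) (A : {set half_edge G}).
Local Notation srt A := (sort (ple P) (enum A)).

Lemma plt_irr g : plt P g g = false.
Proof. by rewrite /plt /= eqxx. Qed.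

Lemma plt_asym g h : plt P g h -> plt P h g = false.
Proof.
rewrite /plt /= => /andP[gh le]; apply/negP => /andP[_ ge].
by move/eqP: gh; apply; apply: (@ple_anti _ P); rewrite le.
Qed.

Lemma plt_total g h : g != h -> plt P g h || plt P h g.
Proof. by rewrite /plt /= [h == g]eq_sym => ->; exact: (@ple_total _ P). Qed.

Lemma plt_nth_sort h0 A i j : (i < j)%N -> (j < #|A|)%N ->
  plt P (nth h0 (srt A) i) (nth h0 (srt A) j).
Proof.
move=> ij jA; have sz : size (srt A) = #|A| by rewrite size_sort cardE.
rewrite /plt /= nth_uniq ?sz ?sort_uniq ?enum_uniq ?(ltn_trans ij) //.
rewrite neq_ltn ij /=.
apply: (sorted_leq_nth (@ple_trans _ P) (@ple_refl _ P)); rewrite ?inE ?sz ?(ltn_trans ij) //.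
  exact: sort_sorted (@ple_total _ P) _.
exact: ltnW.
Qed.

Lemma mem_sort_enum A h : (h \in srt A) = (h \in A).
Proof. by rewrite mem_sort mem_enum. Qed.

Lemma ehalvesP e :
  [/\ plt P (e1 P e) (e2 P e), edg (e1 P e) = e, edg (e2 P e) = e
    & forall h, (edg h == e) = (h == e1 P e) || (h == e2 P e)].
Proof.
have mem h : (h \in ehalves P e) = (edg h == e).
  by rewrite memtE /= mem_sort_enum inE.
have lt : plt P (e1 P e) (e2 P e).
  by rewrite /e1 /e2 !(tnth_nth (e1 P e)) plt_nth_sort // card_edg.
have E : ehalves P e = [:: e1 P e; e2 P e] :> seq _.
  apply: (@eq_from_nth _ (e1 P e)); rewrite ?size_tuple // => -[|[|//]] _ /=.
    by rewrite {2}/e1 (tnth_nth (e1 P e)).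
  by rewrite /e2 (tnth_nth (e1 P e)).
split=> //; try by apply/eqP; rewrite -mem mem_tnth.
by move=> h; rewrite -mem memtE E !inE.
Qed.

Lemma vhalvesP v :
  [/\ plt P (v1 P v) (v2 P v), plt P (v2 P v) (v3 P v), plt P (v1 P v) (v3 P v),
      vtx (v1 P v) = v & triple (v1 P v) (v2 P v) (v3 P v)].
Proof.
have mem h : (h \in vhalves P v) = (vtx h == v).
  by rewrite memtE /= mem_sort_enum inE.
have i1 : (inord 1 : 'I_3) = 1%N :> nat by rewrite inordK.
have lt12 : plt P (v1 P v) (v2 P v).
  by rewrite /v1 /v2 !(tnth_nth (v1 P v)) i1 plt_nth_sort // card_vtx.
have lt23 : plt P (v2 P v) (v3 P v).
  by rewrite /v2 /v3 !(tnth_nth (v1 P v)) i1 plt_nth_sort // card_vtx.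
have lt13 : plt P (v1 P v) (v3 P v).
  by rewrite /v1 /v3 !(tnth_nth (v1 P v)) plt_nth_sort // card_vtx.
have vv : vtx (v1 P v) = v by apply/eqP; rewrite -mem mem_tnth.
have E : vhalves P v = [:: v1 P v; v2 P v; v3 P v] :> seq _.
  apply: (@eq_from_nth _ (v1 P v)); rewrite ?size_tuple // => -[|[|[|//]]] _ /=.
  - by rewrite {2}/v1 (tnth_nth (v1 P v)).
  - by rewrite /v2 (tnth_nth (v1 P v)) i1.
  - by rewrite /v3 (tnth_nth (v1 P v)).
split=> //; split; first by case/andP: lt12.
- by case/andP: lt13.
- by case/andP: lt23.
by move=> h; rewrite vv -mem memtE E !inE.
Qed.

Definition mate h := if h == e1 P (edg h) then e2 P (edg h) else e1 P (edg h).

Lemma e1_neq_e2 e : (e1 P e == e2 P e) = false.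
Proof. by case: (ehalvesP e) => /andP[/negPf]. Qed.

Lemma edg_e1 e : edg (e1 P e) = e. Proof. by case: (ehalvesP e). Qed.
Lemma edg_e2 e : edg (e2 P e) = e. Proof. by case: (ehalvesP e). Qed.

Lemma half_edgeP h : h = e1 P (edg h) \/ h = e2 P (edg h).
Proof.
have [_ _ _ E] := ehalvesP (edg h).
by have := eqxx (edg h); rewrite E => /orP[] /eqP; [left|right].
Qed.

Lemma half_ind (Q : half_edge G -> Prop) :
  (forall e, Q (e1 P e)) -> (forall e, Q (e2 P e)) -> forall h, Q h.
Proof. by move=> Q1 Q2 h; case: (half_edgeP h) => ->. Qed.

Lemma mate_e1 e : mate (e1 P e) = e2 P e.
Proof. by rewrite /mate edg_e1 eqxx. Qed.
Lemma mate_e2 e : mate (e2 P e) = e1 P e.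
Proof. by rewrite /mate edg_e2 eq_sym e1_neq_e2. Qed.

Lemma mateK : involutive mate.
Proof. by apply: half_ind => e; rewrite !(mate_e1, mate_e2). Qed.

Lemma mate_neq h : (mate h == h) = false.
Proof. by elim/half_ind: h => e; rewrite ?mate_e1 ?mate_e2 1?[e2 P e == _]eq_sym e1_neq_e2. Qed.

Lemma edg_mate h : edg (mate h) = edg h.
Proof. by elim/half_ind: h => e; rewrite ?mate_e1 ?mate_e2 edg_e1 edg_e2. Qed.

Lemma big_edge (T : nmodType) (F : half_edge G -> T) :
  \sum_h F h = \sum_e (F (e1 P e) + F (e2 P e)).
Proof.
rewrite (partition_big (@edg G) xpredT) //=; apply: eq_bigr => e _.
have [_ _ _ E] := ehalvesP e.
rewrite (eq_bigl (mem [set e1 P e; e2 P e])); last first.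
  by move=> h; rewrite E !inE.
by rewrite big_setU1 ?inE ?e1_neq_e2 //= big_set1.
Qed.

Lemma big_plt_pair (T : nmodType) (F : half_edge G -> half_edge G -> T) A g h :
  plt P g h -> A = [set g; h] ->
  \sum_(x in A) \sum_(y in A | plt P x y) F x y = F g h.
Proof.
move=> lt ->; have gh : g != h by case/andP: lt.
under eq_bigr => x _ do rewrite big_mkcondr /= big_setU1 ?inE //= big_set1.
by rewrite big_setU1 ?inE //= big_set1 !plt_irr lt (plt_asym lt) !addr0 add0r.
Qed.

Lemma angle_plt (a : angle G) :
  exists g h, [/\ plt P g h, val a = [set g; h] & vtx g = vtx h].
Proof.
have [x [y [z [T Ea]]]] := angle_triple a.
have [vy _] := triple_vtx T; have [xy _ _ _] := T.
case/orP: (plt_total xy) => lt; first by exists x, y.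
by exists y, x; split; rewrite // finset.setUC.
Qed.

End PresentationOrder.

(** * Evaluation by contraction *)

Section Contraction.
Variables (R : realType) (G : trivalent_graph) (P : presentation G).
Local Notation C := R[i].
Local Notation N := (ncoord G).
Implicit Types (g h : half_edge G) (e : edge G) (p q : {mpoly C[N]}).

(** The operator of the edge e contracts z_(e_1) with w_(e_2) with weight 1, and
    w_(e_1) with z_(e_2) with weight -1.  Writing a coordinate as (h, k), with
    k = 0 for z_h and k = 1 for w_h, the weight is the product of a sign that
    depends on h and a sign that depends on k: the matrix of the contraction is,
    for each edge, the tensor square of the rotation by a right angle. *)
Definition half_sign h : C := if h == e1 P (edg h) then 1 else -1.
Definition coord_sign (k : 'I_2) : C := if k == 0 then 1 else -1.
Definition contr_index (i : 'I_N) : 'I_N :=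
  enum_rank (mate P (enum_val i).1, rev_ord (enum_val i).2).
Definition contr_sign (i : 'I_N) : C :=
  half_sign (enum_val i).1 * coord_sign (enum_val i).2.

Lemma half_sign_mate h : half_sign (mate P h) = - half_sign h.
Proof.
rewrite /half_sign edg_mate; elim/(half_ind (P := P)): h => e.
  by rewrite mate_e1 edg_e1 eqxx eq_sym e1_neq_e2.
by rewrite mate_e2 edg_e2 eqxx eq_sym e1_neq_e2 opprK.
Qed.

Lemma half_sign_sqr h : half_sign h * half_sign h = 1.
Proof. by rewrite /half_sign; case: ifP; rewrite ?mulrNN mulr1. Qed.

Lemma coord_sign_sqr k : coord_sign k * coord_sign k = 1.
Proof. by rewrite /coord_sign; case: ifP; rewrite ?mulrNN mulr1. Qed.

Lemma ord2P (k : 'I_2) : k = 0 \/ k = 1.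
Proof. by case: k => [[|[|//]] ?]; [left|right]; apply/val_inj. Qed.

Lemma rev_ord0 : rev_ord (0 : 'I_2) = 1. Proof. exact/val_inj. Qed.
Lemma rev_ord1 : rev_ord (1 : 'I_2) = 0. Proof. exact/val_inj. Qed.

Lemma coord_sign_rev k : coord_sign (rev_ord k) = - coord_sign k.
Proof.
by rewrite /coord_sign; case: (ord2P k) => ->;
  rewrite ?rev_ord0 ?rev_ord1 ?opprK ?eqxx.
Qed.

Lemma contr_indexK : involutive contr_index.
Proof.
move=> i; rewrite /contr_index enum_rankK /= mateK rev_ordK.
by rewrite -surjective_pairing enum_valK.
Qed.

Lemma contr_index_neq i : contr_index i != i.
Proof.
apply/eqP => /(congr1 enum_val); rewrite enum_rankK => /(congr1 fst) /= /eqP.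
by rewrite mate_neq.
Qed.

Lemma contr_sign_index i : contr_sign (contr_index i) = contr_sign i.
Proof.
by rewrite /contr_sign enum_rankK /= half_sign_mate coord_sign_rev mulrNN.
Qed.

Lemma contr_index_zi h : contr_index (zi h) = wi (mate P h).
Proof. by rewrite /contr_index enum_rankK /= rev_ord0. Qed.
Lemma contr_index_wi h : contr_index (wi h) = zi (mate P h).
Proof. by rewrite /contr_index enum_rankK /= rev_ord1. Qed.
Lemma contr_sign_zi h : contr_sign (zi h) = half_sign h.
Proof. by rewrite /contr_sign enum_rankK /= mulr1. Qed.
Lemma contr_sign_wi h : contr_sign (wi h) = - half_sign h.
Proof. by rewrite /contr_sign enum_rankK /= mulrN1. Qed.

Lemma half_sign_e1 e : half_sign (e1 P e) = 1.
Proof. by rewrite /half_sign edg_e1 eqxx. Qed.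
Lemma half_sign_e2 e : half_sign (e2 P e) = -1.
Proof. by rewrite -mate_e1 half_sign_mate half_sign_e1. Qed.

Definition contraction : {mpoly C[N]} -> C := pairing contr_index contr_sign.
HB.instance Definition _ := GRing.Linear.on contraction.

Lemma contraction1 : contraction 1 = 1.
Proof. exact: pairing1. Qed.

Lemma contraction_mulX i p :
  contraction ('X_i * p) = contr_sign i * contraction p^`M(contr_index i).
Proof. exact: (pairing_mulX contr_indexK contr_index_neq contr_sign_index). Qed.

Definition half_euler h p := 'X_(zi h) * p^`M(zi h) + 'X_(wi h) * p^`M(wi h).

Fact half_euler_is_linear h : linear (half_euler h).
Proof.
move=> a p q; rewrite /half_euler !mderivD !mderivZ !mulrDr -!scalerAr scalerDr.
by rewrite addrACA.
Qed.
HB.instance Definition _ h :=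
  GRing.isLinear.Build C {mpoly C[N]} {mpoly C[N]} _ (half_euler h)
    (half_euler_is_linear h).

Lemma half_eulerM h p q :
  half_euler h (p * q) = half_euler h p * q + p * half_euler h q.
Proof. by rewrite /half_euler !mderivM; ring. Qed.

(** Contracting the first factor in the Euler operator of either half of e
    reproduces the operator of e. *)
Lemma contraction_half_euler h p :
  contraction (half_euler h p) = contraction (edge_op P (edg h) p).
Proof.
rewrite linearD /= !contraction_mulX contr_sign_zi contr_sign_wi.
rewrite contr_index_zi contr_index_wi linearB /=.
elim/(half_ind (P := P)): h => e.
  rewrite mate_e1 edg_e1 half_sign_e1 mul1r mulN1r.
  by rewrite [p^`M(zi _)^`M(_)]mderiv_comm.
rewrite mate_e2 edg_e2 half_sign_e2 opprK mul1r mulN1r addrC.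
by rewrite [p^`M(zi _)^`M(_)]mderiv_comm.
Qed.

(** Homogeneity in the two variables of each half-edge is expressed by Euler's
    identity: it is then stable under products because [half_euler] is a
    derivation, and no monomial has to be inspected. *)
Definition multihomog (x : half_edge G -> C) p := forall h, half_euler h p = x h *: p.

Lemma multihomogM x y p q : multihomog x p -> multihomog y q ->
  multihomog (fun h => x h + y h) (p * q).
Proof.
by move=> hp hq h; rewrite half_eulerM hp hq -scalerAl -scalerAr -scalerDl.
Qed.

Lemma multihomogB x p q : multihomog x p -> multihomog x q -> multihomog x (p - q).
Proof. by move=> hp hq h; rewrite linearB /= hp hq scalerBr. Qed.

Lemma eq_multihomog x y p : x =1 y -> multihomog x p -> multihomog y p.
Proof. by move=> xy hp h; rewrite hp xy. Qed.

Lemma multihomog1 : multihomog (fun=> 0) 1.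
Proof. by move=> h; rewrite (derivation1 (half_eulerM h)) scale0r. Qed.

Lemma multihomog_exp x p d : multihomog x p ->
  multihomog (fun h => d%:R * x h) (p ^+ d).
Proof.
move=> hp; elim: d => [|d IH] h; first by rewrite mul0r expr0 multihomog1.
by rewrite exprS (multihomogM hp IH) -natr1 [_ + 1]addrC mulrDl mul1r.
Qed.

Lemma multihomog_prod (I : Type) (r : seq I) (x : I -> half_edge G -> C)
    (p : I -> {mpoly C[N]}) : (forall i, multihomog (x i) (p i)) ->
  multihomog (fun h => \sum_(i <- r) x i h) (\prod_(i <- r) p i).
Proof.
move=> hp; elim: r => [|i r IH] h; first by rewrite !big_nil multihomog1.
by rewrite !big_cons (multihomogM (hp i) IH).
Qed.

(** Both [half_euler] operators of e become the operator of e under the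
    contraction, and they multiply p by its two degrees. *)
Lemma contraction_neq_degree x p e : multihomog x p -> x (e1 P e) != x (e2 P e) ->
  contraction p = 0.
Proof.
move=> hp; have := contraction_half_euler (e1 P e) p.
rewrite edg_e1 -{2}(edg_e2 P e) -contraction_half_euler !hp !linearZ /=.
move=> /eqP; rewrite -subr_eq0 -mulrBl mulf_eq0 subr_eq0.
by case/orP => /eqP -> //; rewrite eqxx.
Qed.

(** Each of the two terms of the operator of e differentiates once with respect
    to the variables of each half of e. *)
Lemma edge_op_multihomog x p e : multihomog x p ->
  multihomog (fun h => x h - (edg h == e)%:R) (edge_op P e p).
Proof.
have zw g h : (zi g == wi h :> 'I_N) = false.
  by rewrite (inj_eq enum_rank_inj) xpair_eqE andbF.
have zz g h : (zi g == zi h :> 'I_N) = (g == h).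
  by rewrite (inj_eq enum_rank_inj) xpair_eqE eqxx andbT.
have ww g h : (wi g == wi h :> 'I_N) = (g == h).
  by rewrite (inj_eq enum_rank_inj) xpair_eqE eqxx andbT.
have cancel_kron (b : bool) (u v w s t : {mpoly C[N]}) : (b -> u = w) ->
    s + t = b%:R * u + s + (0 * v + t) - b%:R *: w.
  rewrite mul0r add0r; case: b => [->|_] //=; last by rewrite mul0r add0r scale0r subr0.
  by rewrite mul1r scale1r -[X in X - _]addrA [RHS]addrC addKr.
have comm_z h g q : half_euler h q^`M(zi g) =
    (half_euler h q)^`M(zi g) - (h == g)%:R *: q^`M(zi g).
  rewrite /half_euler mderivD !mderivM !mderivXU zz [wi _ == _]eq_sym zw.
  rewrite (mderiv_comm (zi g) (zi h)) (mderiv_comm (zi g) (wi h)).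
  by apply: cancel_kron => /eqP ->.
have comm_w h g q : half_euler h q^`M(wi g) =
    (half_euler h q)^`M(wi g) - (h == g)%:R *: q^`M(wi g).
  rewrite /half_euler mderivD !mderivM !mderivXU ww zw.
  rewrite (mderiv_comm (wi g) (zi h)) (mderiv_comm (wi g) (wi h)).
  rewrite [LHS]addrC [X in _ = X - _]addrC.
  by apply: cancel_kron => /eqP ->.
move=> hp h; rewrite /edge_op linearB /= !(comm_z, comm_w) hp.
rewrite !(mderivB, mderivZ).
have -> : (edg h == e)%:R = (h == e1 P e)%:R + (h == e2 P e)%:R :> C.
  have [_ _ _ ->] := ehalvesP P e; case: eqP => [->|] /=; last by rewrite add0r.
  by rewrite e1_neq_e2 addr0.
rewrite -!mul_mpolyC !mpolyCB !mpolyCD; ring.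
Qed.

Lemma contraction_edge_op e d x p : multihomog x p -> x (e1 P e) = d%:R ->
  contraction (iter d (edge_op P e) p) = d`!%:R * contraction p.
Proof.
elim: d x p => [|d IH] x p hp xd; first by rewrite mul1r.
rewrite iterSr (IH _ _ (edge_op_multihomog e hp)); last first.
  by rewrite xd edg_e1 eqxx -natr1 addrK.
have := contraction_half_euler (e1 P e) p; rewrite edg_e1 => <-.
by rewrite hp linearZ /= xd factS natrM mulrCA mulrA.
Qed.

Lemma iter_edge_op_multihomog e d x p : multihomog x p ->
  multihomog (fun h => x h - (edg h == e)%:R * d%:R) (iter d (edge_op P e) p).
Proof.
move=> hp; elim: d => [|d IH] h; first by rewrite mulr0 subr0 hp.
by rewrite iterS (edge_op_multihomog e IH) -natr1 mulrDr mulr1 opprD addrA.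
Qed.

(** The coefficient of a monomial is multiplied in [half_euler] by the degree of
    that monomial in the variables of h, so some h detects any nonconstant
    one. *)
Lemma multihomog0_const p : multihomog (fun=> 0) p -> p = (p@_0%MM)%:MP.
Proof.
move=> hp; apply/mpolyP => m; rewrite mcoeffC; case: eqP => [->|m0]; first by rewrite mulr1.
rewrite mulr0; apply/eqP.
have cX i : ('X_i * p^`M(i))@_m = (m i)%:R * p@_m.
  case: (posnP (m i)) => [mi|mi].
    rewrite mi mul0r; apply: memN_msupp_eq0; apply/negP.
    move=> /(@msuppM_le _ _ _ _ _) /allpairsP[[k1 k2] /= [+ _ E]].
    by rewrite msuppX inE => /eqP k1E; move: mi; rewrite E k1E mnmDE mnm1E eqxx.
  have le : (U_(i) <= m)%MM.
    by apply/mnm_lepP => j; rewrite mnm1E; case: eqP => [<-|].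
  rewrite mulrC -{1}(submK le) addmC mcoeffMX mcoeff_deriv submK //.
  by rewrite mnmBE mnm1E eqxx subn1 prednK // mulr_natl.
have [i mi] : exists i, (0 < m i)%N.
  apply/existsP; apply: contra_notT m0 => /existsPn H; apply/mnmP => i.
  by rewrite mnm0E; apply/eqP; rewrite -leqn0 leqNgt H.
have [h hi] : exists h, i = zi h \/ i = wi h.
  exists (enum_val i).1; rewrite /zi /wi.
  case: (ord2P (enum_val i).2) => <-; [left|right];
  by rewrite -surjective_pairing enum_valK.
have := congr1 (mcoeff m) (hp h); rewrite mcoeffD !cX scale0r mcoeff0 -mulrDl -natrD.
move=> /eqP; rewrite mulf_eq0 pnatr_eq0 addn_eq0 => /orP[/andP[/eqP z0 /eqP w0]|//].
by case: hi => hi; move: mi; rewrite hi ?z0 ?w0.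
Qed.

(** Removing the edges one by one, each step lowers the degree in the variables of
    the two halves of e from c_e to 0 and costs a factor c_e!, out of the
    (c_e!)^2 in the denominator.  What is left in the end is a constant. *)
Lemma contraction_evaluation (c : edge G -> nat) p :
  multihomog (fun h => (c (edg h))%:R) p ->
  (foldr (fun e q => ((c e)`!%:R ^- 2) *: iter (c e) (edge_op P e) q) p
     (enum (edge G)))@_0%MM * \prod_e (c e)`!%:R = contraction p.
Proof.
move=> hp; pose ev := foldr (fun e q => ((c e)`!%:R ^- 2) *: iter (c e) (edge_op P e) q) p.
have fact0 e : (c e)`!%:R != 0 :> C by rewrite pnatr_eq0 -lt0n fact_gt0.
have key es : uniq es ->
    multihomog (fun h => ((edg h \notin es) * c (edg h))%:R) (ev es) /\
    contraction (ev es) * \prod_(e <- es) (c e)`!%:R = contraction p.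
  elim: es => [_|e es IH /= /andP[ees ues]].
    by rewrite big_nil mulr1; split=> // h; rewrite mul1n.
  have [hs Ls] := IH ues; split=> [h|].
    rewrite linearZ /= (iter_edge_op_multihomog e (c e) hs) scalerA mulrC -scalerA.
    rewrite inE; congr (_ *: _); case: eqP => [->|_] /=.
      by rewrite ees mul1r mul1n subrr.
    by rewrite mul0r subr0.
  rewrite big_cons linearZ /= (contraction_edge_op (d := c e) hs); last first.
    by rewrite edg_e1 ees mul1n.
  rewrite -Ls expr2 invfM; set b := \prod_(j <- es) _; set L := contraction _.
  by field; rewrite fact0.
have [hs Ls] := key _ (enum_uniq (edge G)).
rewrite -Ls big_enum; congr (_ * _).
rewrite -/(ev _) [in RHS](@multihomog0_const (ev _)); last first.
  by move=> h; rewrite hs mem_enum.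
by rewrite -[X in _ = contraction X]mulr1 mul_mpolyC linearZ /= contraction1 mulr1.
Qed.

End Contraction.

(** * Angle polynomials and the generating series *)

Section AnglePolynomials.
Variables (R : realType) (G : trivalent_graph) (P : presentation G).
Variable psi : half_edge G -> 'M[R[i]]_2.
Local Notation C := R[i].
Local Notation N := (ncoord G).
Local Notation K := #|{: angle G}|.
Implicit Types (g h : half_edge G) (e : edge G) (a : angle G).

Definition zrow h : 'rV[C]_N :=
  invmx (psi h) 0 0 *: delta_mx 0 (zi h) + invmx (psi h) 0 1 *: delta_mx 0 (wi h).
Definition wrow h : 'rV[C]_N :=
  invmx (psi h) 1 0 *: delta_mx 0 (zi h) + invmx (psi h) 1 1 *: delta_mx 0 (wi h).

Lemma lin_poly_zrow h : lin_poly (zrow h) = zpsi psi h.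
Proof. by rewrite linearD !linearZ /= !lin_poly_delta. Qed.
Lemma lin_poly_wrow h : lin_poly (wrow h) = wpsi psi h.
Proof. by rewrite linearD !linearZ /= !lin_poly_delta. Qed.

(** The factor of a vertex polynomial for the half-edges g < h: it is the
    opposite of the area form on the transported coordinates. *)
Definition bracket g h : {mpoly C[N]} :=
  zpsi psi h * wpsi psi g - zpsi psi g * wpsi psi h.
Definition bracket_mx g h : 'M[C]_N :=
  sym_mul (zrow h) (wrow g) - sym_mul (zrow g) (wrow h).

Definition angle_poly a := \sum_(g in val a) \sum_(h in val a | plt P g h) bracket g h.
Definition angle_mx a := \sum_(g in val a) \sum_(h in val a | plt P g h) bracket_mx g h.

Lemma angle_mx_sym a : (angle_mx a)^T = angle_mx a.
Proof.
rewrite /angle_mx [LHS]raddf_sum; apply: eq_bigr => g _.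
rewrite [LHS]raddf_sum; apply: eq_bigr => h _; exact: trmx_sym_mulB.
Qed.

Lemma bracket_quad g h : bracket g h *+ 2 = quad_poly (bracket_mx g h).
Proof.
by rewrite /bracket -!lin_poly_zrow -!lin_poly_wrow -quad_poly_sym_mulB.
Qed.

Lemma angle_poly_quad a : angle_poly a *+ 2 = quad_poly (angle_mx a).
Proof.
rewrite /angle_mx raddf_sum -sumrMnl; apply: eq_bigr => g _.
rewrite raddf_sum -sumrMnl; apply: eq_bigr => h _; exact: bracket_quad.
Qed.

Lemma lin_multihomog h (u v : C) :
  multihomog (fun k => (k == h)%:R) (u *: 'X_(zi h) + v *: 'X_(wi h) : {mpoly C[N]}).
Proof.
have E (k : half_edge G) (j : 'I_2) :
    half_euler k ('X_(enum_rank (h, j)) : {mpoly C[N]}) =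
    (k == h)%:R *: 'X_(enum_rank (h, j)).
  rewrite /half_euler !mderivXU !(inj_eq enum_rank_inj) !xpair_eqE eq_sym.
  case: (k =P h) => [->|] /=; last by rewrite !mulr0 addr0 scale0r.
  by case: (ord2P j) => -> /=; rewrite mulr0 mulr1 scale1r ?addr0 ?add0r.
by move=> k; rewrite linearD !linearZ /= !E scalerDr !scalerA ![_ * (k == h)%:R]mulrC.
Qed.

Lemma angle_multihomog a : multihomog (fun k => (k \in val a)%:R) (angle_poly a).
Proof.
have [g [h [lt Ea _]]] := angle_plt P a; rewrite /angle_poly (big_plt_pair _ lt Ea).
have gh : g != h by case/andP: lt.
have hM := multihomogM (lin_multihomog h _ _) (lin_multihomog g _ _).
have hM' := multihomogM (lin_multihomog g _ _) (lin_multihomog h _ _).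
apply: (@eq_multihomog _ _ (fun k => (k == h)%:R + (k == g)%:R)) => [k|].
  rewrite Ea !inE; case: (k =P g) => [->|] /=; last by rewrite addr0.
  by rewrite (negPf gh) add0r.
apply: multihomogB; first exact: hM.
by apply: eq_multihomog (hM' _ _ _ _) => k; rewrite addrC.
Qed.

Definition monomial_poly (m : 'X_{1..K}) : {mpoly C[N]} :=
  \prod_(i < K) angle_poly (enum_val i) ^+ m i.

Definition half_degree (m : 'X_{1..K}) h : nat :=
  \sum_(a : angle G | h \in val a) m (enum_rank a).

Lemma monomial_multihomog m :
  multihomog (fun h => (half_degree m h)%:R) (monomial_poly m).
Proof.
move=> h; rewrite (multihomog_prod _ (fun i => multihomog_exp (m i) (angle_multihomog (enum_val i)))).
congr (_ *: _); rewrite /half_degree natr_sum [RHS]big_mkcond /=.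
rewrite [RHS](reindex _ (onW_bij _ (@enum_val_bij (angle G)))) /=.
apply: eq_bigr => i _; rewrite enum_valK.
by case: ifP; rewrite ?mulr1 ?mulr0.
Qed.

Lemma big_angle_vertex (T : comPzSemiRingType) (F : angle G -> T) v a b d :
  val a = [set v1 P v; v2 P v] -> val b = [set v2 P v; v3 P v] ->
  val d = [set v1 P v; v3 P v] ->
  \prod_(x : angle G | [exists h in val x, vtx h == v]) F x = F a * F b * F d.
Proof.
move=> Ea Eb Ed; have [_ _ _ vv T1] := vhalvesP P v.
have T2 := triple_swapl T1; have T3 := triple_swapl (triple_swapr T1).
have [n12 n13 n23 all3] := T1.
have ab : a != b.
  by apply: (angle_neq_triple T2 _ Eb); rewrite Ea finset.setUC.
have ad : a != d by apply: (angle_neq_triple T1 Ea Ed).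
have db : d != b.
  by apply: (angle_neq_triple T3); rewrite ?Ed ?Eb finset.setUC.
rewrite (eq_bigl (mem [set a; b; d])); last first.
  move=> x; rewrite !inE; apply/exists_inP/idP => [[h hx]|].
    rewrite -vv all3 => /or3P[] /eqP hv; move: hx; rewrite hv.
    - by rewrite (mem_angle_triple T1 Ea Ed) => /orP[] ->; rewrite ?orbT.
    - rewrite (mem_angle_triple T2 _ Eb (a := a)); last by rewrite Ea finset.setUC.
      by move=> ->.
    - rewrite (mem_angle_triple T3 _ _ (a := d) (b := b)); last 2 first.
        by rewrite Ed finset.setUC.
        by rewrite Eb finset.setUC.
      by case/orP => ->; rewrite ?orbT.
  have [vv2 _] := triple_vtx T1.
  case/orP=> [/orP[]|] /eqP ->.
  - by exists (v1 P v); rewrite ?Ea ?inE ?eqxx ?vv.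
  - by exists (v2 P v); rewrite ?Eb ?inE ?eqxx ?vv2 ?vv.
  - by exists (v1 P v); rewrite ?Ed ?inE ?eqxx ?vv.
rewrite -finset.setUA !big_setU1 ?inE ?negb_or ?ab ?ad //= ?big_set1 ?mulrA //.
by rewrite eq_sym.
Qed.

(** An angle lies at exactly one vertex, and the three angles at a vertex carry
    the three factors of its polynomial, each with its pair of half-edges taken
    in the order of the presentation. *)
Lemma prod_vertex_poly c :
  \prod_v vertex_poly P psi c v = \prod_(a : angle G) angle_poly a ^+ angle_color c a.
Proof.
have vertexP a : exists v, [exists h in val a, vtx h == v].
  have [g [h [_ Ea _]]] := angle_plt P a.
  by exists (vtx g); apply/exists_inP; exists g; rewrite // Ea !inE eqxx.
have uniqv a v w :
    [exists h in val a, vtx h == v] -> [exists h in val a, vtx h == w] -> v = w.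
  have [x [y [_ Ea vxy]]] := angle_plt P a; rewrite Ea.
  by move=> /exists_inP[g /[!inE] gx /eqP <-] /exists_inP[h /[!inE] hx /eqP <-];
     case/orP: gx => /eqP->; case/orP: hx => /eqP->; rewrite ?vxy.
rewrite [RHS](partition_big (fun a => xchoose (vertexP a)) xpredT) //=.
apply: eq_bigr => v _.
rewrite (eq_bigl (fun a => [exists h in val a, vtx h == v])); last first.
  move=> a; apply/eqP/idP => [<-|av]; first exact: xchooseP (vertexP a).
  exact: uniqv (xchooseP (vertexP a)) av.
have [lt12 lt23 lt13 vv T1] := vhalvesP P v.
have T3 := triple_swapr T1; have T2 := triple_swapr (triple_swapl T1).
have [a Ea] := angle_ex T1; have [b Eb] := angle_ex T2; have [d Ed] := angle_ex T3.
rewrite (big_angle_vertex _ Ea Eb Ed).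
rewrite (angle_color_triple c T1 Ea) (angle_color_triple c T2 Eb) (angle_color_triple c T3 Ed).
rewrite /angle_poly (big_plt_pair _ lt12 Ea) (big_plt_pair _ lt23 Eb) (big_plt_pair _ lt13 Ed).
by [].
Qed.

Lemma divpow_angleE m : divpow (angle_poly \o enum_val) m =
  (\prod_i (m i)`!%:R)^-1 *: monomial_poly m.
Proof. by []. Qed.

Lemma contraction_coloring c :
  admissible c -> planar_presentation P ->
  evaluation_normalized P psi c =
  contraction P (divpow (angle_poly \o enum_val) (angle_mnm c)).
Proof.
move=> adm pl; set m := angle_mnm c; rewrite divpow_angleE linearZ /=.
have mE : monomial_poly m = \prod_v vertex_poly P psi c v.
  rewrite prod_vertex_poly (reindex _ (onW_bij _ (@enum_val_bij (angle G)))) /=.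
  by apply: eq_bigr => i _; rewrite /m mnmE.
have hm h : half_degree m h = c (edg h).
  rewrite -(sum_angle_color h adm); apply: eq_bigr => a _.
  by rewrite mnmE enum_rankK.
have hp : multihomog (fun h => (c (edg h))%:R) (monomial_poly m).
  by move=> h; rewrite monomial_multihomog hm.
rewrite -(contraction_evaluation P hp) mulrC.
rewrite /evaluation_normalized /evaluation -signr_odd (negPf (pl _ adm)) mul1r.
rewrite /evaluation_poly mE; congr (_ / _).
rewrite (reindex _ (onW_bij _ (@enum_val_bij (angle G)))) /=.
by apply: eq_bigr => i _; rewrite /m mnmE.
Qed.

(** Let d_h be the degree of the monomial with exponents m in the variables of
    the half-edge h.  If d takes the same value on the two halves of each edge
    it is an admissible coloring, the only one with X^c = X^m.  Otherwise no
    coloring contributes to the coefficient of X^m and the contraction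
    vanishes. *)
Lemma gen_seriesE : planar_presentation P -> 
  gen_series P psi = expectation (contraction P) (angle_poly \o enum_val).
Proof.
move=> pl; apply: fpsP => m; rewrite [LHS]/= [RHS]/=.
have degE c h : admissible c -> angle_mnm c = m -> half_degree m h = c (edg h).
  move=> adm <-; rewrite -(sum_angle_color h adm); apply: eq_bigr => a _.
  by rewrite mnmE enum_rankK.
case: (boolP [forall e, half_degree m (e1 P e) == half_degree m (e2 P e)]).
  move=> /forallP bal; pose c e := half_degree m (e1 P e).
  have mc h : half_degree m h = c (edg h).
    by rewrite /c; case: (half_edgeP P h) => {1}-> //; rewrite (eqP (bal _)).
  have adm : admissible c by exact: (exponents_admissible mc).
  have cm : angle_mnm c = m.
    by apply/mnmP => i; rewrite mnmE (exponents_angle_color mc) enum_valK.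
  have bd e : (c e < (mdeg m).+1)%N by rewrite ltnS -cm admissible_bound.
  pose cf : {ffun edge G -> 'I_(mdeg m).+1} := [ffun e => inord (c e)].
  have cfE : val \o cf = c by apply: funext => e /=; rewrite ffunE inordK.
  rewrite (big_pred1 cf); first by rewrite cfE (contraction_coloring adm pl) cm.
  move=> c' /=; apply/andP/eqP => [[adm' /eqP cm']|->]; last by rewrite cfE cm.
  apply/ffunP => e; apply: val_inj; rewrite -[RHS]/((val \o cf) e) cfE /c.
  by rewrite (degE _ _ adm' cm') edg_e1.
rewrite negb_forall => /existsP[e ne]; rewrite big_pred0; last first.
  move=> c; apply/negP => /andP[adm /eqP cm]; move/eqP: ne; apply.
  by rewrite !(degE _ _ adm cm) edg_e1 edg_e2.
rewrite divpow_angleE linearZ /= (contraction_neq_degree (monomial_multihomog m) (e := e)) ?mulr0 //.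
by rewrite eqr_nat.
Qed.

End AnglePolynomials.

(** * The matrix of the quadratic form *)

Section ContractionMatrix.
Variables (R : realType) (G : trivalent_graph) (P : presentation G).
Local Notation C := R[i].
Local Notation N := (ncoord G).
Implicit Types (g h : half_edge G) (e : edge G) (i j : 'I_N).

Definition contr_mx : 'M[C]_N := monomial_mx (contr_sign R P) (contr_index P).

Lemma contr_sign_sqr i : contr_sign R P i * contr_sign R P i = 1.
Proof. by rewrite /contr_sign mulrACA half_sign_sqr coord_sign_sqr mulr1. Qed.

Lemma contr_mx_sqr : contr_mx *m contr_mx = 1%:M.
Proof.
rewrite monomial_mxM; apply: monomial_mx_scalar => i /=; first exact: contr_indexK.
by rewrite contr_sign_index contr_sign_sqr.
Qed.

Lemma contr_mx_sym : contr_mx^T = contr_mx.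
Proof.
apply/matrixP => i j; rewrite !mxE.
have -> : (i == contr_index P j) = (j == contr_index P i).
  by rewrite -(inj_eq (inv_inj (contr_indexK P))) contr_indexK eq_sym.
by case: eqP => [->|]; rewrite ?contr_sign_index.
Qed.

Definition mate_index i : 'I_N := enum_rank (mate P (enum_val i).1, (enum_val i).2).

(** On the four coordinates (e_a, b) of an edge, with a and b in {0, 1}, this
    exchanges a and b. *)
Definition transpose_index i : 'I_N :=
  let: (h, k) := enum_val i in
  enum_rank (if k == 0 then e1 P (edg h) else e2 P (edg h),
             if h == e1 P (edg h) then 0 else 1).

Lemma transpose_indexK : involutive transpose_index.
Proof.
move=> i; rewrite -[RHS]enum_valK /transpose_index; case: (enum_val i) => h k.
rewrite enum_rankK; congr enum_rank.
elim/(half_ind (P := P)): h => e; case: (ord2P k) => ->.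
all: by rewrite !(edg_e1, edg_e2) /= ?[e2 P e == _]eq_sym ?eqxx ?e1_neq_e2.
Qed.

Lemma ncoordE : N = (4 * #|edge G|)%N.
Proof.
rewrite /ncoord card_prod card_ord -sum1_card.
by rewrite (big_edge P (fun=> 1%N)) /= sum_nat_const -[(1%N + 1%N)%R]/2%N -mulnA mulnC.
Qed.

(** The matrix T acts as a rotation by a right angle on the index a of (e_a, b)
    and S exchanges a and b, so that S T S acts as the same rotation on b.  Hence
    the contraction matrix is T (S T S), with determinant (det T)^2 = det (T^2). *)
Let T := monomial_mx (fun i => half_sign R P (enum_val i).1) mate_index.
Let S := monomial_mx (fun=> 1 : C) transpose_index.

Let TT : T *m T = (-1)%:M.
Proof.
rewrite monomial_mxM; apply: monomial_mx_scalar => i /=.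
  by rewrite /mate_index enum_rankK /= mateK -surjective_pairing enum_valK.
by rewrite /mate_index enum_rankK /= half_sign_mate mulrN half_sign_sqr.
Qed.

Let SS : S *m S = 1%:M.
Proof.
rewrite monomial_mxM; apply: monomial_mx_scalar => i /=; last by rewrite mulr1.
exact: transpose_indexK.
Qed.

Let contr_mxE : contr_mx = T *m (S *m T *m S).
Proof.
have E : forall i, contr_sign R P i =
      half_sign R P (enum_val i).1 *
      half_sign R P (enum_val (transpose_index (mate_index i))).1 /\
    contr_index P i =
      transpose_index (mate_index (transpose_index (mate_index i))).
  move=> i; rewrite -(enum_valK i) /contr_sign /contr_index /mate_index.
  case: (enum_val i) => h k; rewrite /transpose_index !enum_rankK /=.
  elim/(half_ind (P := P)): h => e; case: (ord2P k) => ->;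
  rewrite ?(mate_e1, mate_e2, edg_e1, edg_e2) ?[e2 P e == _]eq_sym ?eqxx ?e1_neq_e2 /=;
  rewrite ?(mate_e1, mate_e2, edg_e1, edg_e2) ?[e2 P e == _]eq_sym ?eqxx ?e1_neq_e2 /=;
  by rewrite ?rev_ord0 ?rev_ord1 ?(half_sign_e1, half_sign_e2) ?mulr1.
rewrite !monomial_mxM; apply/matrixP => i j; rewrite !mxE /=.
by have [-> ->] := E i; rewrite mulr1 mul1r.
Qed.

(** There are four coordinates per edge, so the factor i contributes i^4 = 1 for
    each edge. *)
Lemma det_contr_mx : \det ('i%C *: contr_mx) = 1.
Proof.
have dS : \det S * \det S = 1 by rewrite -det_mulmx SS det1.
have dT : \det T * \det T = 1.
  rewrite -det_mulmx TT det_scalar ncoordE exprM.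
  by rewrite (_ : (-1) ^+ 4 = 1) ?expr1n // -signr_odd.
have iN : 'i%C ^+ N = 1 :> C.
  by rewrite ncoordE exprM (exprM 'i%C 2 2) sqr_i sqrrN !expr1n.
by rewrite detZ iN mul1r contr_mxE !det_mulmx [_ * \det T * _]mulrAC dS mul1r dT.
Qed.

End ContractionMatrix.
Section FormMatrix.
Local Open Scope complex_scope.
Variables (R : realType) (G : trivalent_graph) (P : presentation G).
Variable psi : half_edge G -> 'M[R[i]]_2.
Local Notation C := R[i].
Local Notation N := (ncoord G).
Local Notation K := #|{: angle G}|.
Implicit Types (x : 'cV[R]_N) (g h : half_edge G) (e : edge G).

Let xC x : 'cV[C]_N := map_mx (fun r => r%:C) x.

Let xCE x h k : xC x (enum_rank (h, k)) 0 = hcoord x h k 0.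
Proof. by rewrite !mxE. Qed.

Lemma zrow_mul x h : (zrow psi h *m xC x) 0 0 = (invmx (psi h) *m hcoord x h) 0 0.
Proof.
rewrite mul_delta2 !xCE [RHS]mxE !big_ord_recl big_ord0 addr0.
by rewrite (_ : lift ord0 ord0 = 1) //; apply: val_inj.
Qed.

Lemma wrow_mul x h : (wrow psi h *m xC x) 0 0 = (invmx (psi h) *m hcoord x h) 1 0.
Proof.
rewrite mul_delta2 !xCE [RHS]mxE !big_ord_recl big_ord0 addr0.
by rewrite (_ : lift ord0 ord0 = 1) //; apply: val_inj.
Qed.

Lemma quad_value_bracket x g h :
  - 'i%C * quad_value (xC x) (bracket_mx psi g h) =
  2%:R * bform (invmx (psi g) *m hcoord x g) (invmx (psi h) *m hcoord x h).
Proof.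
pose X k := invmx (psi k) *m hcoord x k.
have -> : quad_value (xC x) (bracket_mx psi g h) =
    2%:R * (X h 0 0 * X g 1 0 - X g 0 0 * X h 1 0).
  apply: etrans (quad_value_sym_mulB _ _ _ _ _) _.
  by congr (_ * (_ * _ - _ * _)); [exact: zrow_mul | exact: wrow_mul
                                 | exact: zrow_mul | exact: wrow_mul].
rewrite /bform -/(X g) -/(X h).
move: (X g 0 0) (X g 1 0) (X h 0 0) (X h 1 0) => a b c d; ring.
Qed.

Lemma quad_value_contr_mx x :
  'i%C * quad_value (xC x) (contr_mx R P) =
  2%:R * \sum_e bform (hcoord x (e1 P e)) (hcoord x (e2 P e)).
Proof.
rewrite quad_value_monomial_mx.
have -> : \sum_i contr_sign R P i * xC x i 0 * xC x (contr_index P i) 0 =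
    \sum_h (half_sign R P h * (hcoord x h 0 0 * hcoord x (mate P h) 1 0
                              - hcoord x h 1 0 * hcoord x (mate P h) 0 0)).
  rewrite (reindex _ (onW_bij _ (@enum_rank_bij _))) /=.
  pose F h k := contr_sign R P (enum_rank (h, k)) *
     xC x (enum_rank (h, k)) 0 * xC x (contr_index P (enum_rank (h, k))) 0.
  rewrite (eq_bigr (fun p => F p.1 p.2)); last by case.
  rewrite -(pair_bigA _ F) /F /=.
  apply: eq_bigr => h _; rewrite !big_ord_recl big_ord0 addr0.
  rewrite (_ : lift ord0 ord0 = 1); last exact: val_inj.
  rewrite -/(zi h) -/(wi h) contr_sign_zi contr_sign_wi contr_index_zi contr_index_wi.
  by rewrite !xCE mulrBr !mulrA mulNr mulNr.
rewrite (big_edge P) !mulr_sumr; apply: eq_bigr => e _.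
rewrite mate_e1 mate_e2 half_sign_e1 half_sign_e2 /bform.
ring.
Qed.

(** The term with the angles has the opposite sign because the factors of the
    vertex polynomials are opposite to the area form. *)
Definition form_mx : 'M[RX R G]_N :=
  fpsC K 'i%C *: (map_mx (@fpsC K C) (contr_mx R P) -
                coupling (angle_mx P psi \o enum_val)).

Lemma form_mxP : is_form_matrix (Qform P psi) form_mx.
Proof.
split=> [|x].
  rewrite /form_mx couplingE [LHS]linearZ /=; congr (_ *: _).
  rewrite [LHS]linearB /= map_trmx contr_mx_sym; congr (_ - _).
  rewrite [LHS]linear_sum; apply: eq_bigr => a _ /=.
  by rewrite [LHS]linearZ /= map_trmx angle_mx_sym.
have -> : embed x = map_mx (@fpsC K C) (xC x).
  by apply/matrixP => k l; rewrite !mxE.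
rewrite -[RHS]/(quad_value _ _) /form_mx linearZ linearB /= couplingE linear_sum /=.
rewrite quad_value_map mulrBr -rmorphM /= quad_value_contr_mx addrC.
rewrite /Qform rmorphM rmorph_nat rmorph_sum; congr (_ + _).
rewrite -mulrN -sumrN !mulr_sumr (reindex _ (onW_bij _ (@enum_val_bij (angle G)))) /=.
apply: eq_bigr => a _; rewrite enum_valK linearZ /= quad_value_map.
rewrite [fpsX _ _ * _]mulrC mulrN mulrA -mulNr -rmorphM -rmorphN -mulNr /=.
rewrite [LHS]mulr_sumr /angle_mx linear_sum mulr_sumr rmorph_sum mulr_suml /=.
apply: eq_bigr => g _; rewrite [LHS]mulr_sumr linear_sum mulr_sumr rmorph_sum mulr_suml /=.
apply: eq_bigr => h _; rewrite quad_value_bracket; move: (bform _ _) => b.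
rewrite rmorphM rmorph_nat /=.
by rewrite mulrA.
Qed.

Lemma det_form_mx : \det form_mx =
  \det (1%:M - map_mx (@fpsC K C) (contr_mx R P) *m
               coupling (angle_mx P psi \o enum_val)).
Proof.
set B := coupling _; set A := map_mx _ _.
have AA : A *m A = 1%:M by rewrite -map_mxM contr_mx_sqr map_mx1.
have -> : form_mx = map_mx (@fpsC K C) ('i%C *: contr_mx R P) *m (1%:M - A *m B).
  by rewrite map_mxZ -scalemxAl mulmxBr mulmx1 mulmxA AA mul1mx.
by rewrite det_mulmx det_map_mx det_contr_mx rmorph1 mul1r.
Qed.

End FormMatrix.

Theorem theorem1p1 (R : realType) (G : trivalent_graph) (P : presentation G)
    (psi : half_edge G -> 'M[R[i]]_2) :
  planar R G ->
  planar_presentation P ->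
  (forall h, \det (psi h) = 1) ->
  exists2 M : 'M[RX R G]_(ncoord G),
    is_form_matrix (Qform P psi) M & is_inv_sqrt (\det M) (gen_series P psi).
Proof.
move=> _ pl _; exists (form_mx P psi); first exact: form_mxP.
rewrite gen_seriesE // det_form_mx.
apply: gaussian_det.
- exact: contraction1.
- move=> i p; apply: etrans (contraction_mulX P i p) _; rewrite (bigD1 (contr_index P i)) //= mxE eqxx.
  by rewrite big1 ?addr0 // => j /negPf ji; rewrite mxE ji mul0r.
- by move=> a; apply: angle_mx_sym.
- by move=> a; apply: angle_poly_quad.
Qed.
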